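(* Let $p\ge2$. Let $X, X_1, X_2, \dots$ be a stationary sequence of non-degenerate $\rho$-mixing random variables with common density $f$ (with respect to Lebesgue measure), and let $f_{n,K}(x)=\frac{1}{nh_n}\sum_{i=1}^n K\big(\frac{X_i-x}{h_n}\big)$. Assume that: (i) $\sum_{i=0}^{\infty}\rho^{2/p}(2^i)<\infty$; (ii) the bandwidths $h_n>0$ satisfy $h_n\searrow 0$ and $nh_n\to\infty$ as $n\to\infty$; (iii) $f$ is uniformly bounded on $\mathbb{R}$; (iv) $K:\mathbb{R}\to\mathbb{R}$ is measurable with $\sup_{x\in\mathbb{R}}|K(x)|<\infty$ and $\int_{-\infty}^{\infty}|K(x)|\,dx<\infty$. Then $$\bigg[\int_{-\infty}^{\infty}\big\|f_{n,K}(x)-Ef_{n,K}(x)\big\|_p^p\,dx\bigg]^{1/p}=O\Big[\Big(\frac{1}{nh_n}\Big)^{1/2}\Big]\quad\text{as } n\to\infty.$$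
   Context: $\rho$-mixing: for a sequence $X_1,X_2,\dots$ of random variables on a probability space, put $\mathscr{F}_n^-=\sigma(X_i,1\le i\le n)$, $\mathscr{F}_n^+=\sigma(X_i,i\ge n)$ and $$\rho(n)=\sup_{k\ge1}\ \sup_{X\in L^2(\mathscr{F}_k^-)}\ \sup_{Y\in L^2(\mathscr{F}_{k+n}^+)}\frac{|EXY-EXEY|}{\sqrt{E(X-EX)^2E(Y-EY)^2}}.$$ The sequence is $\rho$-mixing if $\rho(n)\to0$ as $n\to\infty$. For a random variable $Y$, $\|Y\|_p=(E|Y|^p)^{1/p}$; $a_n=O(b_n)$ means $\limsup_{n\to\infty}a_n/b_n<\infty$. *)

(* Defs.v *)
From mathcomp Require Import all_boot all_order all_algebra.
From mathcomp Require Import all_classical all_reals all_analysis.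

Set Implicit Arguments.
Unset Strict Implicit.
Unset Printing Implicit Defensive.

Import Order.TTheory GRing.Theory Num.Theory.
Import numFieldNormedType.Exports.

Local Open Scope classical_set_scope.
Local Open Scope ring_scope.
Local Open Scope ereal_scope.

(* A sequence X_1, X_2, ... is a function on nat whose value at 0 is not part
   of the sequence. *)

Definition sigma_seq {d : measure_display} {T : measurableType d}
    {R : realType} {P : probability T R} (X : nat -> {RV P >-> R})
    (I : set nat) : set (set T) :=
  <<s \bigcup_(i in I) preimage_set_system setT (X i) measurable >>.

Definition sigma_past {d : measure_display} {T : measurableType d}
    {R : realType} {P : probability T R} (X : nat -> {RV P >-> R}) (n : nat) :=
  sigma_seq X [set i | (1 <= i <= n)%N].

Definition sigma_future {d : measure_display} {T : measurableType d}
    {R : realType} {P : probability T R} (X : nat -> {RV P >-> R}) (n : nat) :=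
  sigma_seq X [set i | (n <= i)%N].

Definition L2 {d : measure_display} {T : measurableType d} {R : realType}
    (P : probability T R) (F : set (set T)) : set (T -> R) :=
  [set U | U \in Lfun P 2%:E /\ preimage_set_system setT U measurable `<=` F].

(* If U or V is almost surely constant, the quotient is 0 / 0 = 0. *)
Definition correlation {d : measure_display} {T : measurableType d}
    {R : realType} (P : probability T R) (U V : T -> R) : R :=
  (`|fine 'E_P[U \* V] - fine 'E_P[U] * fine 'E_P[V]|
    / Num.sqrt (fine 'V_P[U] * fine 'V_P[V]))%R.

Definition rho {d : measure_display} {T : measurableType d} {R : realType}
    {P : probability T R} (X : nat -> {RV P >-> R}) (n : nat) : \bar R :=
  ereal_sup [set r | exists k U V, [/\ (1 <= k)%N, L2 P (sigma_past X k) U,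
    L2 P (sigma_future X (k + n)) V & r = (correlation P U V)%:E]].

Definition rho_mixing {d : measure_display} {T : measurableType d}
    {R : realType} {P : probability T R} (X : nat -> {RV P >-> R}) : Prop :=
  rho X n @[n --> \oo] --> 0.

(* (X_{k+1}, ..., X_{k+n}) *)
Definition window {d : measure_display} {T : measurableType d}
    {R : realType} {P : probability T R} (X : nat -> {RV P >-> R})
    (k n : nat) (w : T) : n.-tuple R :=
  [tuple X (k + i.+1)%N w | i < n].

(* Strict stationarity; measurable refers to the product sigma-algebra. *)
Definition stationary {d : measure_display} {T : measurableType d}
    {R : realType} {P : probability T R} (X : nat -> {RV P >-> R}) : Prop :=
  forall (k n : nat) (A : set (n.-tuple R)), measurable A ->
    P (window X k n @^-1` A) = P (window X 0 n @^-1` A).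

Definition non_degenerate {d : measure_display} {T : measurableType d}
    {R : realType} {P : probability T R} (Y : {RV P >-> R}) : Prop :=
  ~ exists c : R, {ae P, forall w, Y w = c}.

Definition has_density {d : measure_display} {T : measurableType d}
    {R : realType} {P : probability T R} (Y : {RV P >-> R}) (f : R -> R) :=
  [/\ measurable_fun setT f, (forall x, 0 <= f x)%R &
    forall A : set R, measurable A ->
      distribution P Y A = \int[lebesgue_measure]_(x in A) (f x)%:E].

Definition kernel_estimator {d : measure_display} {T : measurableType d}
    {R : realType} {P : probability T R} (X : nat -> {RV P >-> R})
    (K : R -> R) (h : nat -> R) (n : nat) (x : R) (w : T) : R :=
  (1 / (n%:R * h n) * \sum_(1 <= i < n.+1) K ((X i w - x) / h n))%R.

Definition is_bigO {R : realType} (a : nat -> \bar R) (b : nat -> R) : Prop :=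
  limn_esup (fun n => a n * ((b n)^-1)%:E) < +oo.

(* Main.v *)
(* Rosenthal's inequality for stationary rho-mixing sequences: with
   S_n = sum_(i <= n) phi(X_i) centered,
     E|S_n|^p <= A (n E|phi(X_1)|^p + (n E phi(X_1)^2)^(p/2)),
   where A depends only on p and on sum_i rho(2^i)^(2/p).  Write S_n as two blocks
   U, V of length n/2 separated by a gap of length k = 2^(j/2) (n ~ 2^j), plus two
   sums of length at most k.  Pointwise
     |U + V|^p <= (1 + C e)(|U|^p + |V|^p) + C e^(1 - p/2) |U|^(p/2) |V|^(p/2),
   and rho(k) bounds the covariance of |U|^(p/2) and |V|^(p/2), so any
   e >= rho(k)^(2/p) gives
     E|S_n|^p <= 2 (1 + C e) E|S_(n/2)|^p + C e^(-M) (E S_(n/2)^2)^(p/2) + small.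
   Iterating from n = 1 up to n ~ 2^N with e_j = max(rho(2^(j/2))^(2/p), d^(N - j)),
   d close to 1, keeps sum_j e_j bounded while the powers e_j^(-M) lose nothing
   against the geometric growth of 2^(j(p/2 - 1)).

   The estimator at x is centered by phi = K((. - x)/h) - E K((X - x)/h); both
   moments of phi(X_1) are at most a constant times k(x) = E|K((X - x)/h)|, and
   k <= C h while int k(x) dx = h int |K| by Tonelli. *)

Require Import Defs.
From HB Require Import structures.
From mathcomp Require Import all_boot all_order all_algebra.
From mathcomp Require Import all_classical all_reals all_analysis.
From mathcomp Require Import measurable_realfun ring lra zify.

Set Implicit Arguments.
Unset Strict Implicit.
Unset Printing Implicit Defensive.

Import Order.TTheory GRing.Theory Num.Theory.
Import numFieldNormedType.Exports.

Local Open Scope classical_set_scope.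
Local Open Scope ring_scope.

Ltac nneg := solve
  [ done | exact: powR_ge0 | exact: normr_ge0 | exact: ltW | exact: ler0n
  | exact: expR_ge0 | apply: mulr_ge0; nneg | apply: exprn_ge0; nneg
  | rewrite invr_ge0; nneg | apply: addr_ge0; nneg | lra ].

(** * Elementary inequalities *)

Section elementary_inequalities.
Context {R : realType}.
Implicit Types (p x y u w e v : R).

(** Convexity of [x ^ p] on [1, 2]: the chord takes the value [1 + (2 ^ p - 1) t] at [1 + t]. *)
Lemma powR_add1_le p t : 1 <= p -> 0 <= t <= 1 ->
  (1 + t) `^ p <= 1 + 2 `^ p * t.
Proof.
move=> p1 /andP[t0 t1].
have h : 0 <= 1 - t <= 1 by lra.
have c : ((1 - t) * 1 + (1 - (1 - t)) * 2) `^ p <=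
    (1 - t) * 1 `^ p + (1 - (1 - t)) * 2 `^ p.
  by apply: (@convex_powR R p p1 (Itv01 (proj1 (andP h)) (proj2 (andP h))));
    rewrite inE /= in_itv /= andbT.
have -> : 1 + t = (1 - t) * 1 + (1 - (1 - t)) * 2 by ring.
apply: le_trans c _; rewrite powR1 mulr1 subKr (mulrC t) lerD2r; lra.
Qed.

(** Either [|y| <= e |x|] and [|x + y| <= (1 + e) |x|], or [|x| < |y| / e] and
    [|x + y| <= 2 |y| / e]. Used with [x] the two long blocks and [y] the short remainder, which can
    afford a large coefficient. *)
Lemma powR_norm_add_le p e x y : 1 <= p -> 0 < e <= 1 ->
  `|x + y| `^ p <=
  (1 + 2 `^ p * e) * `|x| `^ p + 2 `^ p * e^-1 `^ p * `|y| `^ p.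
Proof.
move=> p1 /andP[e0 e1]; have p0 : 0 <= p by lra.
have [ye|ye] := leP `|y| (e * `|x|).
  apply: (@le_trans _ _ (((1 + e) * `|x|) `^ p)).
    apply: ge0_ler_powR; rewrite ?nnegrE ?mulr_ge0 ?addr_ge0 ?(ltW e0)//.
    by apply: le_trans (ler_normD _ _) _; lra.
  rewrite powRM ?addr_ge0 ?(ltW e0)//.
  have := powR_add1_le p1 (_ : 0 <= e <= 1); rewrite (ltW e0) e1 => /(_ isT) h.
  by apply: ler_wpDr; [nneg|rewrite ler_wpM2r//; nneg].
apply: (@le_trans _ _ ((2 * (e^-1 * `|y|)) `^ p)).
  apply: ge0_ler_powR; rewrite ?nnegrE ?mulr_ge0 ?invr_ge0 ?(ltW e0)//.
  apply: le_trans (ler_normD _ _) _.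
  have : `|x| <= e^-1 * `|y| by rewrite mulrC ler_pdivlMr// mulrC ltW.
  have : `|y| <= e^-1 * `|y| by rewrite ler_peMl// invf_ge1.
  lra.
rewrite powRM ?mulr_ge0 ?invr_ge0 ?(ltW e0)// powRM ?invr_ge0 ?(ltW e0)//.
rewrite mulrA; apply: ler_wpDl => //; nneg.
Qed.

Lemma powR_norm_add2_le p x y : 0 <= p ->
  `|x + y| `^ p <= 2 `^ p * (`|x| `^ p + `|y| `^ p).
Proof.
move=> p0; wlog xy : x y / `|y| <= `|x|.
  move=> H; have [|/ltW] := leP `|y| `|x|; first exact: H.
  by rewrite addrC (addrC (`|x| `^ p)); exact: H.
apply: (@le_trans _ _ ((2 * `|x|) `^ p)).
  apply: ge0_ler_powR; rewrite ?nnegrE ?mulr_ge0//.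
  apply: le_trans (ler_normD _ _) _; lra.
by rewrite powRM// ler_wpM2l ?powR_ge0// lerDl powR_ge0.
Qed.

(* For [t := |y| / |x| <= 1], [(1 + t) ^ p <= 1 + 2 ^ p t]; either [t <= e], or
   [t <= t ^ (p / 2) * e ^ (1 - p / 2)], which is the cross term. *)
Lemma powR_norm_add_cross_le p e x y : 2 <= p -> 0 < e <= 1 ->
  `|x + y| `^ p <= (1 + 2 `^ p * e) * (`|x| `^ p + `|y| `^ p)
    + 2 `^ p * e `^ (1 - p / 2) * (`|x| `^ (p / 2) * `|y| `^ (p / 2)).
Proof.
move=> p2 /andP[e0 e1]; have p0 : 0 <= p by lra.
wlog xy : x y / `|y| <= `|x|.
  move=> H; have [|/ltW] := leP `|y| `|x|; first exact: H.
  rewrite addrC (addrC (`|x| `^ p)) (mulrC (`|x| `^ (p / 2))); exact: H.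
have [x0|x0] := eqVneq x 0.
  move: xy; rewrite x0 normr0 normr_le0 => /eqP ->; rewrite addr0 normr0.
  have -> : 0 `^ p = 0 :> R by rewrite powR0// gt_eqF//; lra.
  by rewrite addr0 mulr0 add0r; nneg.
have ax : 0 < `|x| by rewrite normr_gt0.
set t := `|y| / `|x|.
have t0 : 0 <= t by rewrite divr_ge0.
have t1 : t <= 1 by rewrite ler_pdivrMr// mul1r.
have yE : `|y| = t * `|x| by rewrite /t divfK// gt_eqF.
clearbody t.
apply: (@le_trans _ _ (((1 + t) * `|x|) `^ p)).
  apply: ge0_ler_powR; rewrite ?nnegrE ?mulr_ge0 ?addr_ge0//.
  apply: le_trans (ler_normD _ _) _; rewrite yE; lra.
rewrite powRM ?addr_ge0//.
have h := powR_add1_le (_ : 1 <= p) (_ : 0 <= t <= 1).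
have {}h : (1 + t) `^ p <= 1 + 2 `^ p * t by apply: h; [lra|rewrite t0].
apply: le_trans (_ : (1 + 2 `^ p * t) * `|x| `^ p <= _).
  by rewrite ler_wpM2r//; nneg.
have [te|te] := leP t e.
  apply: ler_wpDr; first by nneg.
  apply: le_trans (_ : (1 + 2 `^ p * e) * `|x| `^ p <= _).
    by apply: ler_wpM2r; [nneg|rewrite lerD2l; apply: ler_wpM2l; nneg].
  by apply: ler_wpM2l; [nneg|rewrite lerDl; nneg].
have tp : 0 < t by lra.
have tle : t <= e `^ (1 - p / 2) * t `^ (p / 2).
  have tE : t `^ (p / 2) = t * t `^ (p / 2 - 1) by rewrite mulr_powRB1//; lra.
  have -> : e `^ (1 - p / 2) = e^-1 `^ (p / 2 - 1).
    by rewrite -[in RHS]powR_inv1 ?(ltW e0)// -powRrM mulN1r opprB.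
  rewrite tE mulrCA -powRM; [|nneg|nneg]; apply: ler_peMr => //.
  have et : 1 <= e^-1 * t by rewrite mulrC ler_pdivlMr// mul1r ltW.
  rewrite [leLHS](_ : 1 = 1 `^ (p / 2 - 1)); last by rewrite powR1.
  by apply: ge0_ler_powR; rewrite ?nnegrE; nneg.
rewrite yE !powRM//.
have -> : `|x| `^ (p / 2) * (t `^ (p / 2) * `|x| `^ (p / 2)) = t `^ (p / 2) * `|x| `^ p.
  rewrite mulrCA -powRD; first by rewrite -splitr.
  by apply/implyP => _; exact: lt0r_neq0.
rewrite mulrDl mul1r; apply: lerD.
  rewrite mulrDl mul1r -addrA lerDl; nneg.
by rewrite -!mulrA; apply: ler_wpM2l; [nneg|rewrite mulrA; apply: ler_wpM2r; nneg].
Qed.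

(** Either [v <= e |x| ^ 2], which gives the first term, or [|x| ^ 2 < v / e], which gives the
    second. It is applied with [v] the second moment of a sum. *)
Lemma powR_norm_interpolate p e v x : 2 <= p -> 0 < e <= 1 -> 0 <= v ->
  v * `|x| `^ (p - 2) <= e * `|x| `^ p + e^-1 `^ (p / 2 - 1) * v `^ (p / 2).
Proof.
move=> p2 /andP[e0 e1] v0.
have [vx|vx] := leP v (e * `|x| ^+ 2).
  apply: ler_wpDr; first by nneg.
  have -> : `|x| `^ p = `|x| ^+ 2 * `|x| `^ (p - 2).
    rewrite -powR_mulrn// -powRD; first by congr powR; ring.
    by rewrite addrC subrK gt_eqF//; lra.
  by rewrite mulrA; apply: ler_wpM2r; nneg.
apply: ler_wpDl; first by nneg.
have vp : 0 < v by apply: le_lt_trans vx; nneg.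
have -> : `|x| `^ (p - 2) = (`|x| ^+ 2) `^ (p / 2 - 1).
  by rewrite -powR_mulrn// -powRrM; congr powR; field.
have -> : v `^ (p / 2) = v * v `^ (p / 2 - 1).
  by rewrite mulr_powRB1//; lra.
rewrite mulrCA -powRM; [|nneg|nneg]; apply: ler_wpM2l => //.
apply: ge0_ler_powR; rewrite ?nnegrE; [nneg..|].
by rewrite mulrC ler_pdivlMr// mulrC ltW.
Qed.

(** Discrete Gronwall inequality: [1 + e j <= expR (e j)], and each [c j] meets only later factors,
    all at least 1, so the full exponential bounds its weight. *)
Lemma perturbed_recursion (b e c : nat -> R) (N : nat) :
  (forall j, 0 <= e j) -> (forall j, 0 <= c j) -> 0 <= b 0 ->
  (forall j, (j < N)%N -> b j.+1 <= b j * (1 + e j) + c j) ->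
  b N <= expR (\sum_(j < N) e j) * (b 0 + \sum_(j < N) c j).
Proof.
move=> e0 c0 b0; elim: N => [|N IH] bS.
  by rewrite !big_ord0 expR0 addr0 mul1r.
apply: le_trans (bS _ (ltnSn _)) _.
have {}IH := IH (fun j jN => bS _ (ltnW jN)).
rewrite !big_ord_recr /= expRD.
set E := expR (\sum_(j < N) e j) in IH *; set C := \sum_(j < N) c j in IH *.
have C0 : 0 <= C by apply: sumr_ge0.
have E1 : 1 <= E by rewrite -expR0 ler_expR; apply: sumr_ge0.
have eN := expR_ge1Dx (e N).
apply: le_trans (_ : E * (b 0 + C) * (1 + e N) + c N <= _).
  by rewrite lerD2r ler_wpM2r// addr_ge0.
have := e0 N; have := c0 N => cN eN0.
apply: le_trans (_ : E * (b 0 + C) * expR (e N) + E * expR (e N) * c N <= _).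
  apply: lerD; first by rewrite ler_wpM2l// mulr_ge0 ?addr_ge0//; lra.
  by rewrite ler_peMl//; apply: mulr_ege1 => //; lra.
by rewrite le_eqVlt; apply/orP; left; apply/eqP; ring.
Qed.

End elementary_inequalities.

(** * The dyadic recursion *)

Section doubling.
Context {R : realType}.

(** Every number is the half of exactly two indices. The gap at level [j] is [2 ^ j./2], so the
    mixing coefficients enter through [j./2]. *)
Lemma sum_half_le (f : nat -> R) (N : nat) : (forall i, 0 <= f i) ->
  \sum_(j < N) f j./2 <= 2 * \sum_(i < N) f i.
Proof.
move=> f0.
have E : \sum_(j < N.*2) f j./2 = 2 * \sum_(i < N) f i.
  elim: N => [|N IH]; first by rewrite !big_ord0 mulr0.
  rewrite doubleS !big_ord_recr /= IH uphalf_double doubleK; ring.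
rewrite -E -addnn big_split_ord /= lerDl; exact: sumr_ge0.
Qed.

Lemma sum_geometric_le (x : R) (N : nat) : 0 <= x < 1 ->
  \sum_(j < N) x ^+ j <= (1 - x)^-1.
Proof.
move=> /andP[x0 x1]; rewrite -[leRHS]mul1r ler_pdivlMr ?subr_gt0// mulrC.
by rewrite -opprB mulNr -subrX1 opprB gerBl exprn_ge0.
Qed.

(** The gap terms live at level [j./2], a fraction [2 ^ j./2 / 2 ^ j] of the length at level [j], so
    they act as one more multiplicative error beside [e j]. *)
Lemma doubling_recursion (a e t c : nat -> R) (N : nat) :
  (forall n, 0 <= a n) -> a 0%N = 0 -> (forall j, 0 <= e j) ->
  (forall j, 0 <= t j) -> (forall j, 0 <= c j) ->
  (forall j n, (j < N)%N -> (n <= 2 ^ j.+1)%N ->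
    a n <= 2 * (1 + e j) * a n./2 + c j
           + t j * (a (2 ^ j./2)%N + a (2 ^ j./2 - odd n)%N)) ->
  forall n, (n <= 2 ^ N)%N ->
  a n <= 2 ^+ N * (expR (\sum_(j < N) (e j + t j * (2 ^+ j./2 / 2 ^+ j)))
                   * (a 1%N + \sum_(j < N) c j / 2 ^+ j.+1)).
Proof.
move=> a0 a00 e0 t0 c0 aS.
pose e' j := e j + t j * (2 ^+ j./2 / 2 ^+ j).
pose c' j := c j / 2 ^+ j.+1.
have e'0 j : 0 <= e' j.
  by rewrite addr_ge0// mulr_ge0// divr_ge0 ?exprn_ge0.
have c'0 j : 0 <= c' j by rewrite divr_ge0 ?exprn_ge0.
(* [2 ^ j * b j] will majorize [a] up to [2 ^ j]; monotonicity of [b] lets the gap terms, bounded at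
   level [j./2], be expressed through [b j]. *)
pose b := fix b j := if j is j'.+1 then b j' * (1 + e' j') + c' j' else a 1%N.
have b0 j : 0 <= b j.
  by elim: j => [|j IH] //=; rewrite addr_ge0// mulr_ge0// addr_ge0.
have bS j : b j <= b j.+1.
  by rewrite /=; have := e'0 j; have := c'0 j; have := b0 j; nra.
have bh j i : (i <= j)%N -> b i <= b j.
  elim: j => [|j IH]; first by rewrite leqn0 => /eqP->.
  rewrite leq_eqVlt => /predU1P[->//|]; rewrite ltnS => /IH h.
  exact: le_trans h (bS j).
have key j : (j <= N)%N -> forall n, (n <= 2 ^ j)%N -> a n <= 2 ^+ j * b j.
  elim/ltn_ind: j => -[_ _ n|j IH jN n nj].
    rewrite expn0 leq_eqVlt => /predU1P[->|]; rewrite ?expr0 ?mul1r//.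
    by case: n => //; rewrite a00 a0.
  apply: le_trans (aS j n jN nj) _.
  have h1 : a n./2 <= 2 ^+ j * b j.
    apply: IH => //; first exact: ltnW.
    by rewrite -(doubleK (2 ^ j)%N) half_leq// -mul2n -expnS.
  have gj : (j./2 < j.+1)%N by rewrite ltnS -{2}(half_double j) half_leq// -addnn leq_addr.
  have h2 : a (2 ^ j./2)%N <= 2 ^+ j./2 * b j.
    apply: (@le_trans _ _ (2 ^+ j./2 * b j./2)).
      by apply: IH => //; exact: leq_trans (ltnW gj) jN.
    by rewrite ler_wpM2l ?exprn_ge0// bh.
  have h3 : a (2 ^ j./2 - odd n)%N <= 2 ^+ j./2 * b j.
    apply: (@le_trans _ _ (2 ^+ j./2 * b j./2)).
      by apply: IH => //; [exact: leq_trans (ltnW gj) jN|exact: leq_subr].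
    by rewrite ler_wpM2l ?exprn_ge0// bh.
  have X0 : 2 ^+ j != 0 :> R by rewrite expf_neq0// pnatr_eq0.
  have -> : 2 ^+ j.+1 * b j.+1 =
      2 * (1 + e j) * (2 ^+ j * b j) + c j + t j * (2 ^+ j./2 * b j + 2 ^+ j./2 * b j).
    rewrite /= /e' /c' exprS; field; by [].
  apply: lerD; last by rewrite ler_wpM2l// lerD.
  by rewrite lerD2r ler_wpM2l// mulr_ge0// addr_ge0.
move=> n nN; apply: le_trans (key N (leqnn _) n nN) _.
rewrite ler_wpM2l ?exprn_ge0//.
by apply: (@perturbed_recursion R b e' c' N).
Qed.

End doubling.

Lemma pow2_bracket (n : nat) : (0 < n)%N ->
  exists2 N, (n <= 2 ^ N)%N & (2 ^ N <= n.*2)%N.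
Proof.
case: n => // -[|n] _; first by exists 0%N.
have /andP[h1 h2] := @up_log_bounds 2 n.+2 isT isT.
exists (up_log 2 n.+2) => //.
have : (0 < up_log 2 n.+2)%N by case: (up_log 2 n.+2) h2.
by move: h1; case: (up_log _ _) => //= k h1 _; rewrite expnS mul2n leq_double ltnW.
Qed.

(** * Solving the recursions for the second and the [p]-th moments *)

Section rosenthal_recursion.
Context {R : realType}.
Implicit Types (p s : R) (r : nat -> R).

Let z : R := 2 `^ 4^-1.

Let z_gt1 : 1 < z.
Proof.
rewrite -[ltLHS](_ : 1 `^ 4^-1 = 1); last by rewrite powR1.
by apply: gt0_ltr_powR; rewrite ?nnegrE//; lra.
Qed.

Let z4 : z ^+ 4 = 2.
Proof. by rewrite -powR_mulrn ?powR_ge0// -powRrM mulVf// powRr1. Qed.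

(* [slack s j = 2 ^ (- j / (4 s))]: summable in [j], while [slack s j ^ (- s) = 2 ^ (j / 4)]
   is absorbed by the ratio [2 ^ (j / 2) / 2 ^ j] of gap to block length. *)
Definition slack (s : R) (j : nat) : R := (2 `^ (4 * s)^-1)^-1 ^+ j.

Let base_gt1 (x : R) : 0 < x -> 1 < 2 `^ x :> R.
Proof.
move=> x0; rewrite -[ltLHS](_ : 1 `^ x = 1); last by rewrite powR1.
by apply: gt0_ltr_powR; rewrite ?nnegrE//; lra.
Qed.

Lemma slack_itv s j : 0 < s -> 0 < slack s j <= 1.
Proof.
move=> s0; have b1 : 1 < 2 `^ (4 * s)^-1 :> R by apply: base_gt1; rewrite invr_gt0; lra.
rewrite exprn_gt0 ?invr_gt0; last by lra.
by rewrite exprn_ile1 ?invr_ge0 ?invf_le1; lra.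
Qed.

Lemma slackV s j : 0 < s -> (slack s j)^-1 `^ s = z ^+ j.
Proof.
move=> s0; rewrite /slack -exprVn invrK.
have E (x : R) : (2 `^ x) ^+ j = 2 `^ (x * j%:R).
  by rewrite powRrM powR_mulrn ?powR_ge0.
rewrite /z !E -powRrM; congr powR; field; exact: lt0r_neq0.
Qed.

Lemma sum_slack s : 0 < s ->
  exists2 C, 0 <= C & forall N, \sum_(j < N) slack s j <= C.
Proof.
move=> s0; have b1 : 1 < 2 `^ (4 * s)^-1 :> R by apply: base_gt1; rewrite invr_gt0; lra.
have b2 : (2 `^ (4 * s)^-1)^-1 < 1 :> R by rewrite invf_lt1; lra.
exists (1 - (2 `^ (4 * s)^-1)^-1)^-1; first by rewrite invr_ge0 subr_ge0 ltW.
by move=> N; apply: sum_geometric_le; rewrite b2 invr_ge0; nneg.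
Qed.

(** Since [2 = z ^ 4], the summand is [z] to the power [j + 4 * j./2 - 4 * j <= - j]: a geometric
    series dominates. *)
Lemma sum_slackV s : 0 < s -> exists2 C, 0 <= C & forall N,
  \sum_(j < N) (slack s j)^-1 `^ s * (2 ^+ j./2 / 2 ^+ j) <= C.
Proof.
move=> s0; have zi : z^-1 < 1 by rewrite invf_lt1; have := z_gt1; lra.
exists (1 - z^-1)^-1; first by rewrite invr_ge0 subr_ge0 ltW.
move=> N; apply: le_trans (@sum_geometric_le R z^-1 N _); last first.
  by rewrite zi invr_ge0; have := z_gt1; lra.
apply: ler_sum => j _; rewrite slackV//.
have z0 k : 0 < z ^+ k by rewrite exprn_gt0//; have := z_gt1; lra.
rewrite -z4 -!exprM exprVn mulrA ler_pdivrMr// [leRHS]mulrC ler_pdivlMr// -!exprD.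
by rewrite ler_weXn2l//; [have := z_gt1; lra|have := odd_double_half j; lia].
Qed.

(** Numerical core of Rosenthal's inequality: [a] and [v] stand for the [p]-th and second moments of
    the sums, [r i] for the mixing coefficient at gap [2 ^ i]; [t] and [e] are free at each level.
    [A] is fixed before [a] and [v], hence uniform over the summed functions. *)
Lemma rosenthal_recursion p r R0 : 2 <= p -> (forall j, 0 <= r j <= 1) ->
  (forall N, \sum_(j < N) r j `^ (2 / p) <= R0) ->
  exists2 A, 0 <= A & forall a v : nat -> R,
    (forall n, 0 <= a n) -> (forall n, 0 <= v n) -> a 0%N = 0 -> v 0%N = 0 ->
    (p = 2 -> forall n, a n = v n) ->
    (forall j n t, 0 < t <= 1 ->
      v n <= (1 + 2 `^ 2 * t) * (2 * (1 + r j./2) * v n./2)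
        + 2 `^ 2 * t^-1 `^ 2 * (2 `^ 2 * (v (2 ^ j./2)%N + v (2 ^ j./2 - odd n)%N))) ->
    (forall j n t e, 0 < t <= 1 -> 0 < e <= 1 -> r j./2 <= e `^ (p / 2) ->
      a n <= (1 + 2 `^ p * t) * (2 * (1 + 2 * 2 `^ p * e) * a n./2
               + 2 `^ p * (e^-1 `^ ((p / 2 - 1) * (1 + p / 2)) * v n./2 `^ (p / 2)))
        + 2 `^ p * t^-1 `^ p * (2 `^ p * (a (2 ^ j./2)%N + a (2 ^ j./2 - odd n)%N))) ->
    forall n, (0 < n)%N -> a n <= A * (n%:R * a 1%N + (n%:R * v 1%N) `^ (p / 2)).
Proof.
move=> p2 r01 rR0.
have r0 j : 0 <= r j by have /andP[] := r01 j.
(* As [r j <= 1] and [2 / p <= 1], the coefficients themselves have sums bounded by [R0], which the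
   second moments need. *)
have rp j : r j <= r j `^ (2 / p).
  have /andP[_ r1] := r01 j; have := r0 j; rewrite le_eqVlt => /predU1P[<-|rj].
    exact: powR_ge0.
  by apply: ger1_powR; rewrite ?rj// ler_pdivrMr; lra.
have R00 : 0 <= R0 by have := rR0 0%N; rewrite big_ord0.
have [S2 S20 hS2] := @sum_slack 2 (ltr0Sn _ 1).
have [T2 T20 hT2] := @sum_slackV 2 (ltr0Sn _ 1).
have p0 : 0 < p by lra.
have [Sp Sp0 hSp] := @sum_slack p p0.
have [Tp Tp0 hTp] := @sum_slackV p p0.
pose Cv := expR (4 * S2 + 10 * R0 + 16 * T2).
have Cv0 : 0 <= Cv by exact: expR_ge0.
have two2 : 2 `^ 2 = 4 :> R by rewrite -[X in _ `^ X]/(2%:R) powR_mulrn//; ring.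
(* Second moments come first: they grow linearly, and this controls the inhomogeneous term of the
   recursion for [a]. *)
have vbound (v : nat -> R) :
    (forall n, 0 <= v n) -> v 0%N = 0 ->
    (forall j n t, 0 < t <= 1 ->
      v n <= (1 + 2 `^ 2 * t) * (2 * (1 + r j./2) * v n./2)
        + 2 `^ 2 * t^-1 `^ 2 * (2 `^ 2 * (v (2 ^ j./2)%N + v (2 ^ j./2 - odd n)%N))) ->
    forall N n, (n <= 2 ^ N)%N -> v n <= 2 ^+ N * (Cv * v 1%N).
  move=> v0 v00 hv N n nN.
  (* [(1 + 4 s) (1 + r) <= 1 + 4 s + 5 r] for [s <= 1]. The 5 becomes 10 in [Cv] because halving the
     index doubles the bound on the sum of [r]. *)
  pose e j := 4 * slack 2 j + 5 * r j./2.
  pose t j := 16 * (slack 2 j)^-1 `^ 2.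
  have sl j := slack_itv j (ltr0Sn R 1).
  have e0 j : 0 <= e j.
    by have /andP[? _] := sl j; have := r0 j./2; rewrite /e; lra.
  have t0 j : 0 <= t j by rewrite /t; nneg.
  have := @doubling_recursion R v e t (fun=> 0) N v0 v00 e0 t0 (fun=> lexx _).
  move=> /(_ _ n nN) -/(_ _)/le_trans; apply.
    move=> j k _ _; apply: le_trans (hv j k _ (sl j)) _; rewrite two2.
    have /andP[s0 s1] := sl j; have /andP[q0 q1] := r01 j./2; have := v0 k./2.
    move=> V0; rewrite -subr_ge0 /e /t.
    rewrite [leRHS](_ : _ = 8 * v k./2 * r j./2 * (1 - slack 2 j)); last by ring.
    by nneg.
  rewrite ler_wpM2l ?exprn_ge0//; apply: ler_pM; rewrite ?expR_ge0 ?addr_ge0//.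
  - by apply: sumr_ge0 => j _; rewrite mul0r.
  - rewrite ler_expR big_split /=; apply: lerD.
      rewrite big_split /= -!mulr_sumr; apply: lerD; first by rewrite ler_wpM2l ?hS2.
      have := sum_half_le N r0; have := rR0 N.
      have : \sum_(i < N) r i <= \sum_(i < N) r i `^ (2 / p) by apply: ler_sum.
      lra.
    under eq_bigr do rewrite /t -mulrA.
    by rewrite -mulr_sumr ler_wpM2l ?hT2.
  - by rewrite big1 ?addr0// => j _; rewrite mul0r.
(* [de] is chosen so that its power [- (p / 2 - 1) (1 + p / 2)] is [la], the square root of the
   excess growth [2 ^ (p / 2 - 1)] per level. *)
pose de : R := (2 `^ (p + 2)^-1)^-1.
pose la : R := 2 `^ ((p / 2 - 1) / 2).
have la0 : 0 < la by apply: powR_gt0.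
have de01 : 0 < de < 1.
  have b1 : 1 < 2 `^ (p + 2)^-1 :> R by apply: base_gt1; rewrite invr_gt0; lra.
  by rewrite invr_gt0 invf_lt1; lra.
have deV k : (de ^+ k)^-1 `^ ((p / 2 - 1) * (1 + p / 2)) = la ^+ k.
  rewrite /de -exprVn invrK.
  have E (x : R) : (2 `^ x) ^+ k = 2 `^ (x * k%:R).
    by rewrite powRrM powR_mulrn ?powR_ge0.
  by rewrite /la !E -powRrM; congr powR; field; rewrite gt_eqF//; lra.
have two0 : 0 < 2 `^ p :> R by apply: powR_gt0.
(* [Ke] and [Kc] result from bounding [slack] by 1 in the mixed products; [Kt] collects the factors
   of the gap terms. *)
pose Ke := 2 * 2 `^ p * (1 + 2 `^ p).
pose Kc := (1 + 2 `^ p) * 2 `^ p * Cv `^ (p / 2).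
pose Kt := 2 `^ p * 2 `^ p.
pose S := 2 `^ p * Sp + Ke * (2 * R0 + (1 - de)^-1) + Kt * Tp.
pose A := 2 * expR S + expR S * Kc * 2 `^ (p / 2) * (la - 1)^-1.
(* At [p = 2] one has [la = 1] and the geometric sum below would grow with [N]; but then [a = v],
   and the second-moment bound suffices. *)
have [pE|pN2] := eqVneq p 2.
  exists (2 * Cv) => [|a v a0 v0 a00 v00 av hv _ n n0]; first by nneg.
  rewrite !(av pE) pE divff// powRr1 ?mulr_ge0//.
  have [N nN N2n'] := pow2_bracket n0.
have N2n : 2 ^+ N <= 2 * n%:R :> R by rewrite -natrX -natrM ler_nat mul2n.
  apply: le_trans (vbound v v0 v00 hv N n nN) _.
  have := v0 1%N; have := Cv0; have nR : 0 <= n%:R :> R by [].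
  move=> ? ?; rewrite mulrA.
  apply: le_trans (_ : 2 * n%:R * Cv * v 1%N <= _).
    by rewrite ler_wpM2r// ler_wpM2r.
  by rewrite -subr_ge0 [leRHS](_ : _ = 2 * Cv * n%:R * v 1%N); [nneg|ring].
have p2' : 2 < p by rewrite lt_neqAle eq_sym pN2.
have la1 : 1 < la by apply: base_gt1; lra.
exists A => [|a v a0 v0 a00 v00 _ hv ha n n0].
  have laV : 0 <= (la - 1)^-1 by rewrite invr_ge0; lra.
  rewrite /A /Kc; nneg.
have [N nN N2n'] := pow2_bracket n0.
have N2n : 2 ^+ N <= 2 * n%:R :> R by rewrite -natrX -natrM ler_nat mul2n.
(* The second term of the maximum depends on [N]: it is summable over [j < N], and
   [(de ^ (N - j)) ^ (- M) = la ^ (N - j)] is dominated by the growth [la ^ (2 (N - j))]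
   of [2 ^ ((N - j) (p / 2 - 1))]. *)
pose ep j := Num.max (r j./2 `^ (2 / p)) (de ^+ (N - j)).
have ep01 j : 0 < ep j <= 1.
  rewrite /ep lt_max exprn_gt0 ?orbT ?ge_max /=; last by case/andP: de01.
  rewrite exprn_ile1 ?andbT; [|lra..].
  rewrite -[leRHS](_ : 1 `^ (2 / p) = 1); last by rewrite powR1.
  by apply: ge0_ler_powR; rewrite ?nnegrE ?r0 ?divr_ge0//; [lra|case/andP: (r01 j./2)].
have rep j : r j./2 <= ep j `^ (p / 2).
  have -> : r j./2 = (r j./2 `^ (2 / p)) `^ (p / 2).
    rewrite -powRrM (_ : 2 / p * (p / 2) = 1) ?powRr1//.
    by field; rewrite gt_eqF.
  apply: ge0_ler_powR; rewrite ?nnegrE ?powR_ge0 ?divr_ge0//; [lra| |].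
    by case/andP: (ep01 j) => /ltW.
  by rewrite le_max lexx.
have epV j : (ep j)^-1 `^ ((p / 2 - 1) * (1 + p / 2)) <= la ^+ (N - j).
  rewrite -deV; have /andP[e1 _] := ep01 j.
  have d0 : 0 < de ^+ (N - j) by rewrite exprn_gt0; lra.
  apply: ge0_ler_powR; rewrite ?nnegrE; [nneg..|].
  by rewrite lef_pV2 ?posrE// le_max lexx orbT.
have sumep : \sum_(j < N) ep j <= 2 * R0 + (1 - de)^-1.
  apply: (@le_trans _ _ (\sum_(j < N) (r j./2 `^ (2 / p) + de ^+ (N - j)))).
    apply: ler_sum => j _; rewrite /ep ge_max lerDl lerDr powR_ge0 exprn_ge0//; lra.
  rewrite big_split /=; apply: lerD.
    apply: le_trans (@sum_half_le R (fun i => r i `^ (2 / p)) N _) _.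
      by move=> i; exact: powR_ge0.
    by rewrite ler_wpM2l ?rR0.
  apply: (@le_trans _ _ (\sum_(j < N) de ^+ j)).
    rewrite (reindex_inj rev_ord_inj) /=; apply: ler_sum => j _.
    by rewrite (subKn (ltn_ord j)) exprS ler_piMl ?exprn_ge0//; lra.
  by apply: sum_geometric_le; lra.
pose e j := 2 `^ p * slack p j + Ke * ep j.
pose t j := Kt * (slack p j)^-1 `^ p.
pose c j := Kc * v 1%N `^ (p / 2) * la ^+ (N - j) * (2 ^+ j) `^ (p / 2).
have sl j := slack_itv j p0.
have Ke0 : 0 <= Ke by rewrite /Ke; nneg.
have Kc0 : 0 <= Kc by rewrite /Kc; nneg.
have Kt0 : 0 <= Kt by rewrite /Kt; nneg.
have e0 j : 0 <= e j.
  by have /andP[? _] := sl j; have /andP[? _] := ep01 j; rewrite /e; nneg.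
have t0 j : 0 <= t j by rewrite /t; nneg.
have c0 j : 0 <= c j by rewrite /c; nneg.
have := @doubling_recursion R a e t c N a0 a00 e0 t0 c0 _ n nN.
move=> /(_ _)/le_trans; apply.
  move=> j k jN kj; apply: le_trans (ha j k _ _ (sl j) (ep01 j) (rep j)) _.
  have /andP[s0 s1] := sl j; have /andP[q0 q1] := ep01 j.
  have vk : v k./2 `^ (p / 2) <= (2 ^+ j) `^ (p / 2) * (Cv `^ (p / 2) * v 1%N `^ (p / 2)).
    rewrite -powRM; [|nneg|nneg]; rewrite -powRM; [|nneg|nneg].
    apply: ge0_ler_powR; rewrite ?nnegrE; [nneg..|].
    by apply: vbound => //; rewrite -(doubleK (2 ^ j)%N) half_leq// -mul2n -expnS.
  have le1 : (ep j)^-1 `^ ((p / 2 - 1) * (1 + p / 2)) * v k./2 `^ (p / 2) <=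
      la ^+ (N - j) * ((2 ^+ j) `^ (p / 2) * (Cv `^ (p / 2) * v 1%N `^ (p / 2))).
    by apply: ler_pM; rewrite ?powR_ge0.
  rewrite /e /t /c /Ke /Kc /Kt mulrDr; apply: lerD; last first.
    by rewrite le_eqVlt; apply/orP; left; apply/eqP; ring.
  apply: lerD.
    rewrite -subr_ge0 [leRHS](_ : _ =
      4 * (2 `^ p * 2 `^ p) * ep j * (1 - slack p j) * a k./2); last by ring.
    by have ak := a0 k./2; nneg.
  apply: (@le_trans _ _ ((1 + 2 `^ p) * (2 `^ p *
      (la ^+ (N - j) * ((2 ^+ j) `^ (p / 2) * (Cv `^ (p / 2) * v 1%N `^ (p / 2))))))).
    apply: ler_pM; [nneg|nneg| |].
      by rewrite lerD2l; apply: ler_piMr => //; nneg.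
    by apply: ler_wpM2l; [nneg|].
  by rewrite le_eqVlt; apply/orP; left; apply/eqP; ring.
have twoP k : (2 ^+ k) `^ (p / 2) = 2 ^+ k * (la ^+ k) ^+ 2.
  have E (x : R) : (2 `^ x) ^+ k = 2 `^ (x * k%:R).
    by rewrite powRrM powR_mulrn ?powR_ge0.
  rewrite /la E -powR_mulrn ?powR_ge0// -powRrM -!powR_mulrn ?powR_ge0//.
  rewrite -powRrM -powRD; first by congr powR; field.
  by rewrite pnatr_eq0 implybT.
set w := v 1%N `^ (p / 2) in c c0 *.
have w0 : 0 <= w by exact: powR_ge0.
have hexp : expR (\sum_(j < N) (e j + t j * (2 ^+ j./2 / 2 ^+ j))) <= expR S.
  rewrite ler_expR /S big_split /=; apply: lerD.
    rewrite big_split /= -!mulr_sumr; apply: lerD.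
      by apply: ler_wpM2l; [nneg|exact: hSp].
    by apply: ler_wpM2l.
  under eq_bigr do rewrite /t -mulrA.
  by rewrite -mulr_sumr; apply: ler_wpM2l; [nneg|exact: hTp].
(* By [twoP] the summand is [Kc * w * la ^ N * la ^ j / 2]. The last levels dominate the geometric
   sum and leave [la ^ (2 N)], which with the outer factor [2 ^ N] makes [(2 ^ N) ^ (p / 2)]. *)
have hc : \sum_(j < N) c j / 2 ^+ j.+1 <= Kc * w * la ^+ N * (la ^+ N * (la - 1)^-1).
  apply: (@le_trans _ _ (\sum_(j < N) Kc * w * la ^+ N * la ^+ j)).
    apply: ler_sum => j _; rewrite /c twoP.
    have X0 : 2 ^+ j != 0 :> R by rewrite expf_neq0// pnatr_eq0.
    have Y0 : 0 <= la ^+ j by nneg.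
    have -> : la ^+ N = la ^+ (N - j) * la ^+ j by rewrite -exprD subnK// ltnW.
    rewrite (exprS 2 j).
    rewrite [leLHS](_ : _ = 2^-1 * (Kc * w * (la ^+ (N - j) * la ^+ j) * la ^+ j)).
      by apply: ler_piMl; [nneg|lra].
    move: (la ^+ (N - j)) (la ^+ j) (2 ^+ j) X0 => F G X X0.
    by field.
  rewrite -mulr_sumr; apply: ler_wpM2l; first by nneg.
  rewrite ler_pdivlMr; last by lra.
  by rewrite mulrC -subrX1 gerBl.
have {}hc : a 1%N + \sum_(j < N) c j / 2 ^+ j.+1 <=
    a 1%N + Kc * w * la ^+ N * (la ^+ N * (la - 1)^-1) by rewrite lerD2l.
have sc0 : 0 <= a 1%N + \sum_(j < N) c j / 2 ^+ j.+1.
  by rewrite addr_ge0// sumr_ge0// => j _; apply: divr_ge0; nneg.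
apply: (@le_trans _ _ (2 ^+ N * (expR S *
    (a 1%N + Kc * w * la ^+ N * (la ^+ N * (la - 1)^-1))))).
  by apply: ler_wpM2l; [nneg|apply: ler_pM => //; nneg].
have hN : (2 ^+ N) `^ (p / 2) <= 2 `^ (p / 2) * n%:R `^ (p / 2).
  rewrite -powRM//; apply: ge0_ler_powR; rewrite ?nnegrE; nneg.
have laV : 0 <= (la - 1)^-1 by rewrite invr_ge0; lra.
rewrite [leLHS](_ : _ = expR S * a 1%N * 2 ^+ N +
  expR S * Kc * (la - 1)^-1 * w * (2 ^+ N * (la ^+ N) ^+ 2)); last by ring.
rewrite -twoP (powRM _ (ler0n _ _) (v0 _)) -/w.
have ES := expR_ge0 S; have nw : 0 <= n%:R `^ (p / 2) by exact: powR_ge0.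
apply: (@le_trans _ _ (expR S * a 1%N * (2 * n%:R) +
  expR S * Kc * (la - 1)^-1 * w * (2 `^ (p / 2) * n%:R `^ (p / 2)))).
  by apply: lerD; apply: ler_wpM2l => //; nneg.
rewrite -subr_ge0 /A [leRHS](_ : _ = 2 * expR S * n%:R `^ (p / 2) * w +
  expR S * Kc * 2 `^ (p / 2) * (la - 1)^-1 * n%:R * a 1%N); last by ring.
have a10 := a0 1%N;
by repeat first [apply: addr_ge0 | apply: mulr_ge0 | done | exact: powR_ge0 | exact: expR_ge0].
Qed.

End rosenthal_recursion.

(** * Expectation of bounded functions *)

Section bounded_measurable.
Context {d} {T : measurableType d} {R : realType}.
Implicit Types f g : T -> R.

(** A class stable under sums, products and absolute powers, all of whose members are integrable for
    a probability; it contains every function built from the bounded kernel below. *)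
Definition bounded_mfun f :=
  measurable_fun [set: T] f /\ exists b, forall w, `|f w| <= b.

Lemma bounded_mfun_cst (c : R) : bounded_mfun (fun=> c).
Proof. by split; [exact: measurable_cst|exists `|c|]. Qed.

Lemma bounded_mfunD f g :
  bounded_mfun f -> bounded_mfun g -> bounded_mfun (fun w => f w + g w).
Proof.
move=> [mf [a fa]] [mg [b gb]]; split; first exact: measurable_funD.
by exists (a + b) => w; rewrite (le_trans (ler_normD _ _))// lerD.
Qed.

Lemma bounded_mfunM f g :
  bounded_mfun f -> bounded_mfun g -> bounded_mfun (fun w => f w * g w).
Proof.
move=> [mf [a fa]] [mg [b gb]]; split; first exact: measurable_funM.
by exists (a * b) => w; rewrite normrM ler_pM.
Qed.

Lemma bounded_mfunN f : bounded_mfun f -> bounded_mfun (fun w => - f w).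
Proof.
move=> [mf [a fa]]; split; first exact: measurableT_comp.
by exists a => w; rewrite normrN.
Qed.

Lemma bounded_mfunB f g :
  bounded_mfun f -> bounded_mfun g -> bounded_mfun (fun w => f w - g w).
Proof. by move=> bf bg; apply: bounded_mfunD => //; exact: bounded_mfunN. Qed.

Lemma bounded_mfun_sum (I : Type) (s : seq I) (F : I -> T -> R) :
  (forall i, bounded_mfun (F i)) -> bounded_mfun (fun w => \sum_(i <- s) F i w).
Proof.
move=> bF; elim: s => [|i s IH].
  by under eq_fun do rewrite big_nil; exact: bounded_mfun_cst.
by under eq_fun do rewrite big_cons; exact: bounded_mfunD.
Qed.

Lemma bounded_mfun_powR f q : 0 <= q ->
  bounded_mfun f -> bounded_mfun (fun w => `|f w| `^ q).
Proof.
move=> q0 [mf [b fb]]; split.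
  apply: (measurableT_comp (measurable_powR q)); exact: measurableT_comp.
exists (b `^ q) => w; rewrite ger0_norm ?powR_ge0//.
have b0 : 0 <= b by exact: le_trans (fb w).
by apply: ge0_ler_powR; rewrite ?nnegrE.
Qed.

End bounded_measurable.

Local Ltac bounded := repeat first
  [ done | apply: bounded_mfun_cst | apply: bounded_mfunB | apply: bounded_mfunD
  | apply: bounded_mfunM ].

(** * Mean, variance and Cauchy-Schwarz for bounded functions *)

Section mean.
Context {d} {T : measurableType d} {R : realType} (P : probability T R).
Implicit Types f g : T -> R.

Definition mean f : R := \int[P]_w f w.

Definition var f : R := mean (fun w => f w * f w) - mean f ^+ 2.

Lemma meanE f : fine ('E_P[f])%E = mean f.
Proof. by rewrite unlock. Qed.

Lemma bounded_mfun_integrable f :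
  bounded_mfun f -> P.-integrable [set: T] (EFin \o f).
Proof.
move=> [mf [b fb]]; apply: measurable_bounded_integrable => //.
  by rewrite -ge0_fin_numE// fin_num_measure.
by exists b; split; rewrite ?num_real// => x bx w _; exact: le_trans (ltW bx).
Qed.

Lemma EFin_mean f : bounded_mfun f -> (mean f)%:E = (\int[P]_w (f w)%:E)%E.
Proof.
move=> bf; rewrite /mean /Rintegral fineK//; apply: integrable_fin_num => //.
exact: bounded_mfun_integrable.
Qed.

Lemma le_mean f g : bounded_mfun f -> bounded_mfun g ->
  (forall w, f w <= g w) -> mean f <= mean g.
Proof.
move=> bf bg fg; apply: le_Rintegral => //; exact: bounded_mfun_integrable.
Qed.

Lemma mean_ge0 f : (forall w, 0 <= f w) -> 0 <= mean f.
Proof. by move=> f0; apply: Rintegral_ge0. Qed.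

Lemma mean_cst c : mean (fun=> c) = c.
Proof. by rewrite /mean Rintegral_cst//= probability_setT mulr1. Qed.

Lemma eq_mean f g : f =1 g -> mean f = mean g.
Proof. by move=> fg; congr mean; apply/funext. Qed.

Lemma meanD f g : bounded_mfun f -> bounded_mfun g ->
  mean (fun w => f w + g w) = mean f + mean g.
Proof. by move=> bf bg; apply: RintegralD => //; exact: bounded_mfun_integrable. Qed.

Lemma meanZ c f : bounded_mfun f -> mean (fun w => c * f w) = c * mean f.
Proof. by move=> bf; apply: RintegralZl => //; exact: bounded_mfun_integrable. Qed.

Lemma meanB f g : bounded_mfun f -> bounded_mfun g ->
  mean (fun w => f w - g w) = mean f - mean g.
Proof.
move=> bf bg; rewrite meanD//; last exact: bounded_mfunN.
by congr (_ + _); rewrite -mulN1r -meanZ//; apply: eq_mean => w; rewrite mulN1r.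
Qed.

Lemma mean_sum (I : Type) (s : seq I) (F : I -> T -> R) :
  (forall i, bounded_mfun (F i)) ->
  mean (fun w => \sum_(i <- s) F i w) = \sum_(i <- s) mean (F i).
Proof.
move=> bF; elim: s => [|i s IH].
  by under eq_fun do rewrite big_nil; rewrite big_nil mean_cst.
under eq_fun do rewrite big_cons.
by rewrite meanD ?big_cons ?IH//; exact: bounded_mfun_sum.
Qed.

(* The quadratic polynomial [t |-> mean ((f - t g) ^ 2)] is nonnegative. *)
Lemma cauchy_schwarz_mean f g : bounded_mfun f -> bounded_mfun g ->
  mean (fun w => f w * g w) ^+ 2 <=
  mean (fun w => f w * f w) * mean (fun w => g w * g w).
Proof.
move=> bf bg.
set a := mean (fun w => f w * f w); set b := mean (fun w => f w * g w).
set c := mean (fun w => g w * g w).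
have Q t : 0 <= a - 2 * t * b + t ^+ 2 * c.
  rewrite (_ : _ + _ = mean (fun w => (f w - t * g w) ^+ 2)); last first.
    rewrite /a /b /c -!meanZ -?meanB -?meanD; [by apply: eq_mean => w; ring|by bounded..].
  by apply: mean_ge0 => w; exact: sqr_ge0.
have c0 : 0 <= c by apply: mean_ge0 => w; rewrite -expr2 sqr_ge0.
move: c0; rewrite le_eqVlt => /predU1P[c0|c0].
  have [->|b0] := eqVneq b 0; first by rewrite -c0 mulr0 expr0n.
  (* With [c = 0] the polynomial is affine in [t], and this [t] would give it the value [-1]. *)
  have := Q ((a + 1) / (2 * b)); rewrite -c0 mulr0 addr0.
  rewrite (_ : 2 * _ * b = a + 1); first by lra.
  by field.
have := Q (b / c); rewrite (_ : _ + _ = a - b ^+ 2 / c); last by field; rewrite gt_eqF.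
by rewrite subr_ge0 ler_pdivrMr.
Qed.

Lemma var_ge0 f : bounded_mfun f -> 0 <= var f.
Proof.
move=> bf; have := cauchy_schwarz_mean bf (bounded_mfun_cst 1).
rewrite !mulr1 mean_cst mulr1 /var subr_ge0.
by rewrite (_ : (fun w => f w * 1) = f)//; apply/funext => w; rewrite mulr1.
Qed.

Lemma cov_var_le f g : bounded_mfun f -> bounded_mfun g ->
  `|mean (fun w => f w * g w) - mean f * mean g| <= Num.sqrt (var f * var g).
Proof.
move=> bf bg.
have H (u v : T -> R) : bounded_mfun u -> bounded_mfun v ->
    mean (fun w => (u w - mean u) * (v w - mean v)) =
    mean (fun w => u w * v w) - mean u * mean v.
  move=> bu bv.
  transitivity (mean (fun w => u w * v w - (mean v * u w + mean u * v w) + mean u * mean v)).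
    by apply: eq_mean => w; ring.
  rewrite meanD ?meanB ?meanD ?meanZ ?mean_cst; [by ring|by bounded..].
rewrite -H// -sqrtr_sqr ler_wsqrtr//.
have -> : var f = mean (fun w => (f w - mean f) * (f w - mean f)) by rewrite H.
have -> : var g = mean (fun w => (g w - mean g) * (g w - mean g)) by rewrite H.
by apply: cauchy_schwarz_mean; apply: bounded_mfunB => //; exact: bounded_mfun_cst.
Qed.

Lemma bounded_mfun_Lfun2 f : bounded_mfun f -> f \in Lfun P 2%:E.
Proof.
move=> bf; have [mf _] := bf; rewrite inE; apply/andP; split; rewrite inE//=.
rewrite /finite_norm unlock /Lnorm poweR_lty//.
have bf2 : bounded_mfun (fun w => `|f w| `^ 2) by exact: bounded_mfun_powR.
have := ltry (mean (fun w => `|f w| `^ 2)); rewrite EFin_mean//.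
Qed.

Lemma fine_variance f : bounded_mfun f -> fine ('V_P[f])%E = var f.
Proof.
move=> bf; have L2 := bounded_mfun_Lfun2 bf.
have L1 := Lfun_subset12 (fin_num_measure P _ measurableT) L2.
rewrite varianceE// fineB ?expectation_fin_num//; last first.
- by rewrite expe2 fin_numM// expectation_fin_num.
- by rewrite expr2; exact: Lfun2_mul_Lfun1.
by rewrite meanE expe2 fineM ?expectation_fin_num// meanE -expr2.
Qed.

End mean.

(** * Mixing and stationarity *)

Section mixing.
Context {d} {T : measurableType d} {R : realType} {P : probability T R}.
Variable X : nat -> {RV P >-> R}.
Implicit Types (U V : T -> R) (phi : R -> R) (I : set nat).

(** The pair of constants [0] has correlation [0], so [0] lies in the set whose supremum is
    taken. *)
Lemma rho_ge0 n : (0 <= rho X n)%E.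
Proof.
apply: ereal_sup_ubound; exists 1%N, (cst 0), (cst 0).
have cstS (F : set (set T)) : F set0 -> F setT ->
    preimage_set_system setT (cst (0 : R)) measurable `<=` F.
  move=> F0 FT A [B _ <-]; rewrite setTI preimage_cst.
  by case: ifP.
have L2c (F : set (set T)) : F set0 -> F setT -> L2 P F (cst 0).
  by move=> F0 FT; split; [exact: Lfun_cst|exact: cstS].
have sT (G : set (set T)) : <<s G >> set0 /\ <<s G >> setT.
  by split; [exact: (@measurable0 _ (g_sigma_algebraType G))|
             exact: (@measurableT _ (g_sigma_algebraType G))].
split => //; try by apply: L2c; apply sT.
rewrite /correlation (_ : (cst 0 \* cst 0 : T -> R) = cst 0); last first.
  by apply/funext => w /=; rewrite mul0r.
by rewrite expectation_cst /= mul0r subrr normr0 mul0r.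
Qed.

(* By Cauchy-Schwarz, truncating the mixing coefficient at 1 loses nothing. *)
Definition rho1 n : R := Num.min 1 (fine (rho X n)).

Lemma rho1_itv n : 0 <= rho1 n <= 1.
Proof. by rewrite le_min ler01 fine_ge0 ?rho_ge0//= ge_min lexx. Qed.

(** The definition of [rho] with the denominator cleared. Finiteness of [rho X n] matters because
    [fine] sends [+oo] to 0. *)
Lemma rho_cov_le k n U V : (1 <= k)%N -> (rho X n < +oo)%E ->
  bounded_mfun U -> bounded_mfun V ->
  preimage_set_system setT U measurable `<=` sigma_past X k ->
  preimage_set_system setT V measurable `<=` sigma_future X (k + n) ->
  `|mean P (fun w => U w * V w) - mean P U * mean P V| <=
  rho1 n * Num.sqrt (var P U * var P V).
Proof.
move=> k1 rn bU bV aU aV; have CS := cov_var_le P bU bV.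
have sq0 := sqrtr_ge0 (var P U * var P V).
rewrite /rho1 minr_pMl// le_min mul1r CS /=.
(* When a variance vanishes the quotient says nothing, but Cauchy-Schwarz then makes the covariance
   zero. *)
move: sq0; rewrite le_eqVlt => /predU1P[s0|s0].
  by rewrite -s0 mulr0 s0.
rewrite -ler_pdivrMr// -lee_fin fineK ?ge0_fin_numE ?rho_ge0//.
apply: ereal_sup_ubound; exists k, U, V; split => //.
- by split => //; exact: bounded_mfun_Lfun2.
- by split => //; exact: bounded_mfun_Lfun2.
- by rewrite /correlation !fine_variance// !meanE.
Qed.

(** The block starts after index [k], as in [window], so index 0 never occurs. *)
Definition partial_sum phi (k m : nat) (w : T) : R :=
  \sum_(i < m) phi (X (k + i.+1)%N w).

Lemma partial_sumD phi k m n w :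
  partial_sum phi k (m + n) w = partial_sum phi k m w + partial_sum phi (k + m) n w.
Proof.
rewrite /partial_sum big_split_ord /=; congr (_ + _).
by apply: eq_bigr => i _; rewrite addnS addnA -addnS.
Qed.

Lemma bounded_mfun_RV phi (i : nat) :
  bounded_mfun phi -> bounded_mfun (fun w => phi (X i w)).
Proof.
by move=> [mphi [b pb]]; split; [exact: measurableT_comp|exists b => w].
Qed.

Lemma bounded_partial_sum phi k m :
  bounded_mfun phi -> bounded_mfun (partial_sum phi k m).
Proof. by move=> bphi; apply: bounded_mfun_sum => i; exact: bounded_mfun_RV. Qed.

(** Measurability is checked on [T] equipped with the generated sigma-algebra, where each [X i] with
    [i] in [I] is measurable by construction. *)
Lemma partial_sum_adapted phi (g : R -> R) I k m :
  measurable_fun [set: R] phi -> measurable_fun [set: R] g ->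
  (forall i, (i < m)%N -> I (k + i.+1)%N) ->
  preimage_set_system setT (g \o partial_sum phi k m) measurable `<=` sigma_seq X I.
Proof.
move=> mphi mg Ik.
pose G := \bigcup_(i in I) preimage_set_system setT (X i) measurable.
have mX (i : 'I_m) : measurable_fun [set: g_sigma_algebraType G]
    (X (k + i.+1)%N : g_sigma_algebraType G -> R).
  move=> _ B mB; apply: sub_sigma_algebra.
  by exists (k + i.+1)%N; [exact: Ik|exists B].
have mS : measurable_fun [set: g_sigma_algebraType G]
    (g \o partial_sum phi k m : g_sigma_algebraType G -> R).
  apply: measurableT_comp => //.
  by apply: measurable_sum => i; exact: measurableT_comp.
by move=> A [B mB <-]; exact: mS.
Qed.

(** The sum is a function of [window], so the mean is an integral against the law of the window,
    which stationarity makes independent of [k]. *)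
Lemma mean_partial_sum phi (g : R -> R) k m : stationary X ->
  measurable_fun [set: R] phi -> measurable_fun [set: R] g ->
  (forall x, 0 <= g x) ->
  mean P (fun w => g (partial_sum phi k m w)) =
  mean P (fun w => g (partial_sum phi 0 m w)).
Proof.
move=> st mphi mg g0.
pose h (t : m.-tuple R) := g (\sum_(i < m) phi (tnth t i)).
have mh : measurable_fun [set: m.-tuple R] h.
  apply: measurableT_comp => //; apply: measurable_sum => i.
  by apply: measurableT_comp => //; exact: measurable_tnth.
have mW j : measurable_fun [set: T] (window X j m).
  apply/measurable_fun_tnthP => i.
  rewrite (_ : _ \o _ = X (j + i.+1)%N)//.
  by apply/funext => w; rewrite /= tnth_mktuple.
have E j : mean P (fun w => g (partial_sum phi j m w)) =
    fine (\int[pushforward P (window X j m)]_t (h t)%:E)%E.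
  rewrite ge0_integral_pushforward//=; last 2 first.
  - exact/measurable_EFinP.
  - by move=> t _; rewrite lee_fin g0.
  rewrite /mean /Rintegral preimage_setT; congr fine; apply: eq_integral => w _.
  rewrite /= /h /partial_sum; congr (g _)%:E; apply: eq_bigr => i _.
  by rewrite tnth_mktuple.
rewrite !E; congr fine; apply: eq_measure_integral => A mA _.
exact: st.
Qed.

End mixing.

(** * Rosenthal's inequality *)

Section moments.
Context {d} {T : measurableType d} {R : realType} {P : probability T R}.
Variables (X : nat -> {RV P >-> R}) (phi : R -> R).
Hypothesis Xstat : stationary X.
Hypothesis bphi : bounded_mfun phi.
Implicit Types (p q e t : R) (k m n : nat).

Local Notation S := (partial_sum X phi).

Definition moment q n : R := mean P (fun w => `|S 0 n w| `^ q).

Lemma moment_ge0 q n : 0 <= moment q n.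
Proof. by apply: mean_ge0 => w; exact: powR_ge0. Qed.

Lemma moment0 q : 0 < q -> moment q 0 = 0.
Proof.
move=> q0; rewrite /moment -[RHS](mean_cst P 0); apply: eq_mean => w.
by rewrite /partial_sum big_ord0 normr0 powR0 ?gt_eqF.
Qed.

Let mphi : measurable_fun [set: R] phi. Proof. by case: bphi. Qed.

Let mpow q : measurable_fun [set: R] (fun x => `|x| `^ q).
Proof. exact: (measurableT_comp (measurable_powR q) (@normr_measurable _ setT)). Qed.

Lemma moment_shift q k n : mean P (fun w => `|S k n w| `^ q) = moment q n.
Proof. exact: (mean_partial_sum k n Xstat mphi (mpow q) (fun x => powR_ge0 _ _)). Qed.

Let bS k n : bounded_mfun (S k n). Proof. exact: bounded_partial_sum. Qed.

Let bSp q k n : 0 <= q -> bounded_mfun (fun w => `|S k n w| `^ q).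
Proof. by move=> q0; exact: bounded_mfun_powR. Qed.

Local Ltac bounded_sums := repeat first
  [ done | exact: bSp | apply: bounded_mfun_powR | apply: bounded_mfun_cst
  | apply: bounded_mfunB | apply: bounded_mfunD | apply: bounded_mfunM | lra ].

(** The two halves and the gap cover [n + (k - odd n)] indices, so the overshoot beyond [n] is
    subtracted; [odd n <= k] keeps the natural subtraction exact. *)
Lemma partial_sum_gap n k w : (odd n <= k)%N -> S 0 n w =
  S 0 n./2 w + S (n./2 + k) n./2 w + (S n./2 k w - S n (k - odd n) w).
Proof.
move=> ok; have := partial_sumD X phi 0 n (k - odd n) w.
rewrite (_ : (n + (k - odd n) = n./2 + k + n./2)%N); last first.
  by rewrite -{1}(odd_double_half n) -addnn; lia.
rewrite (partial_sumD X phi 0 (n./2 + k)) (partial_sumD X phi 0 n./2 k) !add0n.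
by move=> ?; lra.
Qed.

(** [t] trades a factor close to 1 on the two long blocks against a large constant on the gap and
    the overshoot. *)
Lemma moment_gap q t n k : 1 <= q -> 0 < t <= 1 -> (odd n <= k)%N ->
  moment q n <= (1 + 2 `^ q * t) * mean P (fun w => `|S 0 n./2 w + S (n./2 + k) n./2 w| `^ q)
    + 2 `^ q * t^-1 `^ q * (2 `^ q * (moment q k + moment q (k - odd n))).
Proof.
move=> q1 /andP[t0 t1] ok; have q0 : 0 <= q by lra.
rewrite -(moment_shift q n./2 k) -(moment_shift q n (k - odd n)) -meanD; [|bounded_sums..].
rewrite -!meanZ -?meanD; [|bounded_sums..].
apply: le_mean => [||w]; [bounded_sums..|].
rewrite (partial_sum_gap _ ok).
apply: le_trans (powR_norm_add_le (e := t) _ _ q1 _) _; first by rewrite t0.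
rewrite lerD2l; apply: ler_wpM2l; first by nneg.
by apply: le_trans (powR_norm_add2_le _ _ q0) _; rewrite normrN.
Qed.

(** * Two blocks of length [m] separated by a gap of length [k] *)

Section two_blocks.
Variables (m k : nat).
Hypothesis rk : (rho X k < +oo)%E.

Lemma partial_sum_cov_le (g : R -> R) : measurable_fun [set: R] g ->
  (forall j, bounded_mfun (g \o S j m)) ->
  `|mean P (fun w => g (S 0 m w) * g (S (m + k) m w))
    - mean P (g \o S 0 m) * mean P (g \o S (m + k) m)| <=
  rho1 X k * Num.sqrt (var P (g \o S 0 m) * var P (g \o S (m + k) m)).
Proof.
(* [rho] takes past sigma-algebras of index at least 1 only, so the empty block is treated apart;
   its covariance is zero. *)
move=> mg bg; have [->|m0] := posnP m.
  have H j : g \o S j 0 = fun=> g 0.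
    by apply/funext => w; rewrite /= /partial_sum big_ord0.
  have H2 : (fun w => g (S 0 0 w) * g (S (0 + k) 0 w)) = fun=> g 0 * g 0.
    by apply/funext => w; rewrite /partial_sum !big_ord0.
  rewrite H2 !H !mean_cst subrr normr0 mulr_ge0 ?sqrtr_ge0//.
  by case/andP: (rho1_itv X k).
apply: (@rho_cov_le _ _ _ _ X m k (g \o S 0 m) (g \o S (m + k) m)) => //.
- by apply: partial_sum_adapted => // i im; rewrite /= add0n.
- by apply: partial_sum_adapted => // i im; rewrite /= leq_addr.
Qed.

(** Both blocks are centered with the same variance, so their covariance is at most [rho1 X k] times
    that variance. *)
Lemma two_block_variance : (forall i, mean P (phi \o X i) = 0) ->
  mean P (fun w => `|S 0 m w + S (m + k) m w| `^ 2) <=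
  2 * (1 + rho1 X k) * moment 2 m.
Proof.
move=> phi0.
have sq (x : R) : `|x| `^ 2 = x * x.
  by rewrite -[X in _ `^ X]/(2%:R) powR_mulrn// real_normK ?num_real.
have S0 j : mean P (S j m) = 0.
  rewrite (mean_sum P _ (fun i : 'I_m => bounded_mfun_RV X (j + i.+1) bphi)).
  by rewrite big1// => i _; exact: phi0.
have V j : var P (S j m) = moment 2 m.
  by rewrite /var S0 expr0n subr0 -(moment_shift 2 j); apply: eq_mean => w; rewrite sq.
have := @partial_sum_cov_le id (@measurable_id _ _ _) (fun j => bS j m).
rewrite !S0 mulr0 subr0 !V -expr2 sqrtr_sqr (ger0_norm (moment_ge0 _ _)) => C.
have {}C := le_trans (ler_norm _) C.
rewrite (@eq_mean _ _ _ P _ (fun w => `|S 0 m w| `^ 2 + `|S (m + k) m w| `^ 2 +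
  2 * (S 0 m w * S (m + k) m w))); last by move=> w; rewrite !sq; ring.
rewrite meanD ?meanD ?meanZ; [|bounded_sums..].
by rewrite !moment_shift; move: C => /=; lra.
Qed.

(* [mean |S|^(p/2)] is controlled through Cauchy-Schwarz by
   [mean S^2 * mean |S|^(p-2)]. *)
Lemma two_block_moment p e : 2 <= p -> 0 < e <= 1 -> rho1 X k <= e `^ (p / 2) ->
  mean P (fun w => `|S 0 m w + S (m + k) m w| `^ p) <=
  2 * (1 + 2 * 2 `^ p * e) * moment p m
  + 2 `^ p * (e^-1 `^ ((p / 2 - 1) * (1 + p / 2)) * moment 2 m `^ (p / 2)).
Proof.
move=> p2 e01 re; have /andP[e0 e1] := e01.
have p20 : 0 <= p / 2 by lra.
pose g (x : R) := `|x| `^ (p / 2).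
set c := mean P (fun w => g (S 0 m w) * g (S (m + k) m w)).
have gg j w : g (S j m w) * g (S j m w) = `|S j m w| `^ p.
  rewrite /g; have [->|x0] := eqVneq (S j m w) 0.
    by rewrite normr0 !powR0 ?mulr0 ?gt_eqF//; lra.
  by rewrite -powRD; [rewrite -splitr|rewrite normr_eq0 x0 implybT].
have bg j : bounded_mfun (g \o S j m) by exact: bSp.
have Vg j : var P (g \o S j m) <= moment p m.
  rewrite /var (eq_mean _ (gg j)) moment_shift; have := sqr_ge0 (mean P (g \o S j m)); lra.
have Eg j : mean P (g \o S j m) = moment (p / 2) m by exact: moment_shift.
(* The assumption on [rho1 X k] is scaled so that, against the factor [e ^ (1 - p / 2)] of the cross
   term, exactly [e] remains. *)
have C : c <= e `^ (p / 2) * moment p m + moment (p / 2) m ^+ 2.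
  have := le_trans (ler_norm _) (@partial_sum_cov_le g (mpow _) bg).
  rewrite -/c !Eg -expr2 lerBlDr => /le_trans; apply; rewrite lerD2r.
  apply: ler_pM; rewrite ?sqrtr_ge0//; first by case/andP: (rho1_itv X k).
  rewrite -[leRHS](ger0_norm (moment_ge0 p m)) -sqrtr_sqr ler_wsqrtr// expr2.
  by apply: ler_pM => //; apply: var_ge0.
have E01 : 0 < e `^ (p / 2) <= 1.
  rewrite powR_gt0//= -[leRHS](_ : 1 `^ (p / 2) = 1); last by rewrite powR1.
  by apply: ge0_ler_powR; rewrite ?nnegrE//; lra.
have H : moment (p / 2) m ^+ 2 <=
    e `^ (p / 2) * moment p m + (e `^ (p / 2))^-1 `^ (p / 2 - 1) * moment 2 m `^ (p / 2).
  pose u w := `|S 0 m w| `^ 1; pose v w := `|S 0 m w| `^ ((p - 2) / 2).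
  have bu : bounded_mfun u by exact: bSp.
  have bv : bounded_mfun v by apply: bSp; lra.
  have mE : moment (p / 2) m = mean P (fun w => u w * v w).
    apply: eq_mean => w; rewrite /u /v powRr1//.
    rewrite (_ : (p - 2) / 2 = p / 2 - 1); last by field.
    by rewrite mulr_powRB1//; lra.
  rewrite mE; apply: le_trans (cauchy_schwarz_mean _ bu bv) _.
  have -> : mean P (fun w => u w * u w) = moment 2 m.
    apply: eq_mean => w; rewrite /u !powRr1// -expr2.
    by rewrite -[X in _ `^ X]/(2%:R) powR_mulrn.
  have -> : mean P (fun w => v w * v w) = mean P (fun w => `|S 0 m w| `^ (p - 2)).
    apply: eq_mean => w; rewrite /v.
    have [->|pn2] := eqVneq p 2; first by rewrite subrr mul0r powRr0 mulr1.
    have [->|x0] := eqVneq (S 0 m w) 0.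
      have h : p - 2 != 0 by rewrite subr_eq0.
      by rewrite normr0 !powR0 ?mulr0// mulf_neq0// invr_neq0// pnatr_eq0.
    by rewrite -powRD; [rewrite -splitr|rewrite normr_eq0 x0 implybT].
  rewrite -meanZ; last by apply: bSp; lra.
  rewrite -[X in _ <= _ + X](mean_cst P) /moment -meanZ; last by apply: bSp; lra.
  rewrite -meanD; [|bounded_sums..].
  apply: le_mean => [||w]; [bounded_sums..|].
  by apply: powR_norm_interpolate => //; exact: moment_ge0.
(* Origin of the exponent: the cross term costs [e ^ (1 - p / 2)], and interpolation at level
   [e ^ (p / 2)] costs that level to the power [1 - p / 2]. *)
have eE : e `^ (1 - p / 2) * (e `^ (p / 2))^-1 `^ (p / 2 - 1) =
    e^-1 `^ ((p / 2 - 1) * (1 + p / 2)).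
  have eV (x : R) : e^-1 `^ x = e `^ (- x).
    by rewrite -(powR_inv1 (ltW e0)) -powRrM mulN1r.
  rewrite -powRN -powRrM -powRD; last by rewrite (gt_eqF e0) implybT.
  by rewrite eV; congr powR; field.
have ee : e `^ (1 - p / 2) * e `^ (p / 2) = e.
  by rewrite -powRD ?subrK ?powRr1 ?ltW// (gt_eqF e0) implybT.
apply: (@le_trans _ _ ((1 + 2 `^ p * e) * (2 * moment p m) + 2 `^ p * e `^ (1 - p / 2) * c)).
  rewrite (_ : 2 * moment p m = mean P (fun w => `|S 0 m w| `^ p + `|S (m + k) m w| `^ p)).
    rewrite /c -!meanZ -?meanD; [|bounded_sums..].
    apply: le_mean => [||w]; [bounded_sums..|].
    exact: powR_norm_add_cross_le.
  rewrite meanD; [|apply: bSp; lra..].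
  by rewrite !moment_shift; ring.
apply: (@le_trans _ _ ((1 + 2 `^ p * e) * (2 * moment p m) + 2 `^ p * e `^ (1 - p / 2) *
   (2 * (e `^ (p / 2) * moment p m) +
    (e `^ (p / 2))^-1 `^ (p / 2 - 1) * moment 2 m `^ (p / 2)))).
  by rewrite lerD2l; apply: ler_wpM2l; [nneg|lra].
rewrite -eE le_eqVlt; apply/orP; left; apply/eqP.
have -> : 2 * (1 + 2 * 2 `^ p * e) * moment p m =
    2 * (1 + 2 `^ p * e) * moment p m
    + 2 * 2 `^ p * (e `^ (1 - p / 2) * e `^ (p / 2)) * moment p m by rewrite ee; ring.
by ring.
Qed.

End two_blocks.

End moments.

(** [A] is chosen before [phi], so that one constant serves the centered kernels at all points and
    all bandwidths. *)
Theorem rosenthal_rho_mixing {d} {T : measurableType d} {R : realType}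
    {P : probability T R} (X : nat -> {RV P >-> R}) (p : R) :
  2 <= p -> stationary X ->
  (\sum_(0 <= i <oo) rho X (2 ^ i)%N `^ (2 / p) < +oo)%E ->
  exists2 A, 0 <= A & forall phi : R -> R, bounded_mfun phi ->
    (forall i, mean P (phi \o X i) = 0) -> forall n, (0 < n)%N ->
    moment X phi p n <=
    A * (n%:R * moment X phi p 1 + (n%:R * moment X phi 2 1) `^ (p / 2)).
Proof.
move=> p2 Xstat hrho.
have p20 : 2 / p != 0 :> R by rewrite mulf_neq0 ?invr_neq0 ?pnatr_eq0// gt_eqF//; lra.
have term0 i : (0 <= rho X (2 ^ i)%N `^ (2 / p))%E by exact: poweR_ge0.
have part N : (\sum_(i < N) rho X (2 ^ i)%N `^ (2 / p) <=
    \sum_(0 <= i <oo) rho X (2 ^ i)%N `^ (2 / p))%E.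
  by rewrite -(big_mkord xpredT (fun i => rho X (2 ^ i)%N `^ (2 / p))%E);
    apply: nneseries_lim_ge => i _.
(* Each term of a finite series is finite and [2 / p] is nonzero, so the coefficients are finite, as
   the covariance bound requires. *)
have fin i : (rho X (2 ^ i)%N < +oo)%E.
  apply: (lty_poweRy p20); apply: le_lt_trans hrho; apply: le_trans (part i.+1).
  by rewrite big_ord_recr /= leeDr// sume_ge0.
pose r i := rho1 X (2 ^ i).
pose R0 := fine (\sum_(0 <= i <oo) rho X (2 ^ i)%N `^ (2 / p))%E.
have rR0 N : \sum_(j < N) r j `^ (2 / p) <= R0.
  rewrite -lee_fin fineK; last by rewrite ge0_fin_numE// nneseries_ge0.
  apply: le_trans (part N); rewrite -sumEFin; apply: lee_sum => i _.
  rewrite -[leRHS]fineK; last first.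
    by rewrite ge0_fin_numE// (poweR_lty)// fin.
  rewrite fine_poweR lee_fin.
  have /andP[r0 _] := rho1_itv X (2 ^ i).
  apply: ge0_ler_powR; rewrite ?nnegrE ?fine_ge0 ?rho_ge0//.
    by rewrite divr_ge0//; lra.
  by rewrite /r /rho1 ge_min lexx orbT.
have [A A0 HA] := @rosenthal_recursion R p r R0 p2 (fun i => rho1_itv X _) rR0.
exists A => // phi bphi phi0 n n0.
apply: HA => //.
- exact: moment_ge0.
- exact: moment_ge0.
- by apply: moment0; lra.
- exact: moment0.
- by move=> ->.
- move=> j k t t01.
  have ok : (odd k <= 2 ^ j./2)%N by apply: leq_trans (leq_b1 _) _; rewrite expn_gt0.
  apply: le_trans (moment_gap Xstat bphi _ t01 ok) _; first by lra.
  rewrite lerD2r; apply: ler_wpM2l; last exact: two_block_variance.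
  by case/andP: t01 => ? _; rewrite addr_ge0// mulr_ge0 ?powR_ge0// ltW.
- move=> j k t e t01 e01 re.
  have ok : (odd k <= 2 ^ j./2)%N by apply: leq_trans (leq_b1 _) _; rewrite expn_gt0.
  apply: le_trans (moment_gap Xstat bphi _ t01 ok) _; first by lra.
  rewrite lerD2r; apply: ler_wpM2l; last exact: two_block_moment.
  by case/andP: t01 => ? _; rewrite addr_ge0// mulr_ge0 ?powR_ge0// ltW.
Qed.

(** * Integrals against Lebesgue measure *)

Section lebesgue_affine.
Context {R : realType}.
Local Open Scope ereal_scope.
Local Notation leb := (@lebesgue_measure R).

(* Unlike [ge0_le_integral], no measurability is required: the integral of a
   nonnegative function is a supremum over the simple functions below it. *)
Lemma ge0_le_integralT {d} {T : measurableType d} (mu : {measure set T -> \bar R})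
    (f g : T -> \bar R) :
  (forall x, 0 <= f x) -> (forall x, f x <= g x) ->
  \int[mu]_x f x <= \int[mu]_x g x.
Proof.
move=> f0 fg; have g0 x : 0 <= g x by exact: le_trans (fg x).
rewrite !ge0_integralTE//; apply: le_ereal_sup => _ [h hf <-].
by exists h => // x; exact: le_trans (hf x) (fg x).
Qed.

(** Lebesgue measure divided by [a] and pushed along [x |-> (x - b) / a] agrees with Lebesgue
    measure on half-open intervals, hence everywhere by uniqueness. *)
Lemma ge0_integral_affine (G : R -> \bar R) (a b : R) : (0 < a)%R ->
  measurable_fun [set: R] G -> (forall y, 0 <= G y) ->
  \int[leb]_x G ((x - b) / a)%R = a%:E * \int[leb]_x G x.
Proof.
move=> a0 mG G0.
pose phi : measurableTypeR R -> measurableTypeR R := fun x => ((x - b) / a)%R.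
have mphi : measurable_fun [set: measurableTypeR R] phi.
  by apply: measurable_funM => //; exact: measurable_funB.
have aV0 : (0 <= a^-1)%R by rewrite invr_ge0 ltW.
pose k := NngNum aV0.
have E (A : set R) : measurable A -> pushforward (mscale k leb) phi A = leb A.
  move=> mA; apply/esym/lebesgue_measure_unique => //= _ [[c e]] _ <-.
  rewrite /mscale /pushforward /=.
  rewrite [X in _ * leb X](_ : _ = `](a * c + b)%R, (a * e + b)%R]%classic); last first.
    apply/seteqP; split => x /=; rewrite !in_itv /= /phi
      ltr_pdivlMr// ler_pdivrMr// ltrBrDr lerBlDr !(mulrC a) => //.
  rewrite !lebesgue_measure_itv /= !lte_fin ltrD2r ltr_pM2l//.
  case: ifP => _; last by rewrite mule0.
  rewrite -!EFinD -EFinM; congr EFin.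
  by field; rewrite gt_eqF.
have -> : \int[leb]_x G x = a^-1%:E * \int[leb]_x G ((x - b) / a)%R.
  transitivity (\int[pushforward (mscale k leb) phi]_x G x).
    by apply: eq_measure_integral => A mA _; exact/esym/E.
  rewrite ge0_integral_pushforward// preimage_setT ge0_integral_mscale//=.
  exact: (measurableT_comp mG mphi).
by rewrite muleA -EFinM mulfV ?gt_eqF// mul1e.
Qed.

Lemma ge0_integral_reflect (G : R -> \bar R) (a b : R) : (0 < a)%R ->
  measurable_fun [set: R] G -> (forall y, 0 <= G y) ->
  \int[leb]_x G ((b - x) / a)%R = a%:E * \int[leb]_x G x.
Proof.
move=> a0 mG G0.
have mN : measurable_fun [set: measurableTypeR R] (-%R : measurableTypeR R -> measurableTypeR R).
  exact: oppr_measurable.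
have NE (H : R -> \bar R) : measurable_fun [set: R] H -> (forall y, 0 <= H y) ->
    \int[leb]_x H (- x)%R = \int[leb]_x H x.
  move=> mH H0.
  transitivity (\int[pushforward leb (-%R : measurableTypeR R -> measurableTypeR R)]_x H x).
    by rewrite ge0_integral_pushforward.
  by apply: eq_measure_integral => A mA _; exact: lebesgue_measureN.
rewrite -(NE G)// -(@ge0_integral_affine (fun x => G (- x)%R) a b)//.
  by apply: eq_integral => x _; congr G; rewrite -mulNr opprB.
exact: measurableT_comp.
Qed.

End lebesgue_affine.

(** * Laws with a bounded density *)

Section density.
Context {d} {T : measurableType d} {R : realType} {P : probability T R}.
Local Notation leb := (@lebesgue_measure R).

(** As a measure, the law of [Y] is at most [M] times Lebesgue measure. *)
Lemma integral_density_le (Y : {RV P >-> R}) (f : R -> R) (M : R) (G : R -> \bar R) :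
  has_density Y f -> 0 <= M -> (forall x, f x <= M) ->
  measurable_fun [set: R] G -> (forall x, (0 <= G x)%E) ->
  (\int[P]_w G (Y w) <= M%:E * \int[leb]_x G x)%E.
Proof.
move=> [mf f0 fY] M0 fM mG G0.
(* [lebesgue_measure] lives on [measurableTypeR R], whose display is not that of [R]. *)
have mY : measurable_fun [set: T] (Y : T -> measurableTypeR R).
  by move=> _ A mA; exact: (measurable_funPT Y).
pose Z : {mfun T >-> measurableTypeR R} :=
  HB.pack (Y : T -> measurableTypeR R) (isMeasurableFun.Build _ _ _ _ _ mY).
pose k := NngNum M0.
rewrite -[M]/(k%:num) -(@ge0_integral_distribution _ _ _ (measurableTypeR R) _ P Z G mG G0).
rewrite -(ge0_integral_mscale leb (@measurableT _ (measurableTypeR R)) k mG (fun x _ => G0 x)).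
apply: (@ge0_le_measure_integral _ (measurableTypeR R) R
  (distribution P Z) (mscale k leb)) => // A mA.
rewrite [leLHS](fY A mA).
apply: (@le_trans _ _ (\int[leb]_(x in A) M%:E)%E); last by rewrite integral_cst.
apply: ge0_le_integral => //.
- by move=> x _; rewrite lee_fin.
- by apply/measurable_EFinP; exact: measurable_funTS.
- by move=> x _; rewrite lee_fin.
Qed.

Lemma mean_density (Y Z : {RV P >-> R}) (f g : R -> R) :
  has_density Y f -> has_density Z f -> bounded_mfun g ->
  mean P (fun w => g (Y w)) = mean P (fun w => g (Z w)).
Proof.
move=> [_ _ fY] [_ _ fZ] bg; have [mg [b gb]] := bg.
have E (W : {RV P >-> R}) : mean P (fun w => g (W w)) =
    fine (\int[distribution P W]_x (g x)%:E)%E.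
  rewrite integral_distribution//; first exact/measurable_EFinP.
  apply: bounded_mfun_integrable; split; first exact: measurableT_comp.
  by exists b => w.
rewrite !E; congr fine; apply: eq_measure_integral => A mA _.
exact: etrans (fY A mA) (esym (fZ A mA)).
Qed.

Lemma measurable_affine (c a : R) : measurable_fun [set: R] (fun x : R => (x - c) / a).
Proof. by apply: measurable_funM => //; exact: measurable_funB. Qed.

(** Tonelli: for fixed [w] the integral over [x] is [h] times that of [|K|], wherever [Y w] lies. *)
Lemma integral_mean_kernel (Y : {RV P >-> R}) (K : R -> R) (h : R) : 0 < h ->
  bounded_mfun K ->
  (\int[leb]_x (mean P (fun w => `|K ((Y w - x) / h)|))%:E =
   h%:E * \int[leb]_x `|K x|%:E)%E.
Proof.
move=> h0 bK; have [mK [b Kb]] := bK.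
pose F (z : T * R) := `|K ((Y z.1 - z.2) / h)|%:E.
have mF : measurable_fun [set: T * R] F.
  apply/measurable_EFinP; apply: measurableT_comp => //.
  apply: measurableT_comp => //; apply: measurable_funM => //.
  apply: measurable_funB => //.
  exact: measurableT_comp.
transitivity (\int[leb]_x \int[P]_w F (w, x))%E.
  apply: eq_integral => x _; rewrite EFin_mean//.
  split; last by exists b => w; rewrite normr_id.
  apply: measurableT_comp => //; apply: measurableT_comp => //.
  exact: (measurableT_comp (measurable_affine x h)).
rewrite -fubini_tonelli//; last by move=> z; rewrite lee_fin.
transitivity (\int[P]_w (h%:E * \int[leb]_x `|K x|%:E))%E.
  apply: eq_integral => w _.
  rewrite (@ge0_integral_reflect R (fun y => `|K y|%:E) h (Y w))//.
  by apply/measurable_EFinP; exact: measurableT_comp.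
by rewrite integral_cst//= probability_setT mule1.
Qed.

End density.

(** * The kernel estimator *)

Section kernel_estimator_moments.
Context {d} {T : measurableType d} {R : realType} {P : probability T R}.
Variables (X : nat -> {RV P >-> R}) (f K : R -> R) (B : R).
Hypothesis Xdens : forall i, has_density (X i) f.
Hypothesis bK : bounded_mfun K.
Hypothesis KB : forall x, `|K x| <= B.
Implicit Types (h x u q : R).

Definition kernel_mean (h x : R) : R := mean P (fun w => `|K ((X 1%N w - x) / h)|).

(** Centering by the mean under [X 1] serves every index, all [X i] having the same density. *)
Definition centered_kernel (h x u : R) : R :=
  K ((u - x) / h) - mean P (fun w => K ((X 1%N w - x) / h)).

Let bKx (h x : R) : bounded_mfun (fun u : R => K ((u - x) / h)).
Proof.
have [mK [b Kb]] := bK; split; last by exists b => u.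
exact: (measurableT_comp mK (measurable_affine x h)).
Qed.

Let bKX (h x : R) i : bounded_mfun (fun w => K ((X i w - x) / h)).
Proof. exact: (bounded_mfun_RV X i (bKx h x)). Qed.

Lemma bounded_centered_kernel h x : bounded_mfun (centered_kernel h x).
Proof. by apply: bounded_mfunB; [exact: bKx|exact: bounded_mfun_cst]. Qed.

Lemma mean_kernel h x i :
  mean P (fun w => K ((X i w - x) / h)) = mean P (fun w => K ((X 1%N w - x) / h)).
Proof. exact: (mean_density (Xdens i) (Xdens 1) (bKx h x)). Qed.

Lemma mean_centered_kernel h x i : mean P (centered_kernel h x \o X i) = 0.
Proof.
rewrite [LHS](meanB P (bKX h x i) (bounded_mfun_cst _)) mean_cst mean_kernel.
by rewrite subrr.
Qed.

Let B0 : 0 <= B. Proof. exact: le_trans (KB 0). Qed.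

Lemma centered_kernel_le h x u : `|centered_kernel h x u| <= 2 * B.
Proof.
apply: le_trans (ler_normB _ _) _.
have : `|K ((u - x) / h)| <= B by [].
have : `|mean P (fun w => K ((X 1%N w - x) / h))| <= B.
  rewrite ler_norml; apply/andP; split.
    rewrite -[leLHS](mean_cst P); apply: le_mean => // [|w]; first exact: bounded_mfun_cst.
    by have := KB ((X 1%N w - x) / h); rewrite ler_norml => /andP[].
  rewrite -[leRHS](mean_cst P); apply: le_mean => // [|w]; first exact: bounded_mfun_cst.
  by have := KB ((X 1%N w - x) / h); rewrite ler_norml => /andP[].
lra.
Qed.

Lemma moment1E h x q :
  moment X (centered_kernel h x) q 1 = mean P (fun w => `|centered_kernel h x (X 1%N w)| `^ q).
Proof. by apply: eq_mean => w; rewrite /partial_sum big_ord1. Qed.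

(** Centering can only lower the second moment, and [K ^ 2 <= B |K|]. *)
Lemma moment2_kernel_le h x :
  moment X (centered_kernel h x) 2 1 <= B * kernel_mean h x.
Proof.
have bY := bKX h x 1%N; set Y := (fun w => _) in bY.
have baY : bounded_mfun (fun w => `|Y w|).
  have [mY [b Yb]] := bY; split; first exact: measurableT_comp.
  by exists b => w; rewrite normr_id.
rewrite moment1E (@eq_mean _ _ _ P _
  (fun w => Y w * Y w + (mean P Y ^+ 2 + - (2 * mean P Y) * Y w))).
  rewrite meanD ?meanD ?meanZ ?mean_cst; try by repeat first
    [done | exact: bounded_mfun_cst | apply: bounded_mfunM | apply: bounded_mfunD].
  apply: (@le_trans _ _ (mean P (fun w => Y w * Y w))).
    by have := sqr_ge0 (mean P Y); lra.
  rewrite -meanZ//; apply: le_mean => [||w].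
  - exact: bounded_mfunM.
  - by apply: bounded_mfunM => //; exact: bounded_mfun_cst.
  - by rewrite (le_trans (ler_norm _))// normrM ler_wpM2r//; exact: KB.
move=> w; rewrite -[X in _ `^ X]/(2%:R) powR_mulrn// real_normK ?num_real//.
rewrite /centered_kernel -/(Y w) -/Y; ring.
Qed.

(** The centered kernel is at most [2 B] in absolute value: [p - 2] powers are pulled out and the
    second moment is left. *)
Lemma momentp_kernel_le h x p : 2 <= p ->
  moment X (centered_kernel h x) p 1 <= (2 * B) `^ (p - 2) * (B * kernel_mean h x).
Proof.
move=> p2; apply: (@le_trans _ _
    ((2 * B) `^ (p - 2) * moment X (centered_kernel h x) 2 1)); last first.
  by apply: ler_wpM2l; [exact: powR_ge0|exact: moment2_kernel_le].
have bq q : 0 <= q -> bounded_mfun (fun w => `|centered_kernel h x (X 1%N w)| `^ q).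
  move=> q0; apply: bounded_mfun_powR => //.
  exact: (bounded_mfun_RV X 1%N (bounded_centered_kernel h x)).
rewrite !moment1E -meanZ; last exact: bq.
apply: le_mean => [||w].
- by apply: bq; lra.
- by apply: bounded_mfunM; [exact: bounded_mfun_cst|exact: bq].
set z := `|_|; have z0 : 0 <= z by exact: normr_ge0.
have -> : z `^ p = z `^ (p - 2) * z `^ 2.
  rewrite -powRD; first by congr powR; ring.
  by rewrite subrK gt_eqF//; lra.
apply: ler_wpM2r; first exact: powR_ge0.
apply: ge0_ler_powR; rewrite ?nnegrE ?mulr_ge0//; first lra.
exact: centered_kernel_le.
Qed.

Lemma kernel_estimator_centered (h : nat -> R) n x w : (0 < n)%N ->
  kernel_estimator X K h n x w - mean P (kernel_estimator X K h n x) =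
  (n%:R * h n)^-1 * partial_sum X (centered_kernel (h n) x) 0 n w.
Proof.
move=> n0.
have E v : kernel_estimator X K h n x v =
    (n%:R * h n)^-1 * \sum_(i < n) K ((X i.+1 v - x) / h n).
  by rewrite /kernel_estimator div1r big_add1 /= big_mkord.
have -> : mean P (kernel_estimator X K h n x) =
    (n%:R * h n)^-1 * \sum_(i < n) mean P (fun w => K ((X i.+1 w - x) / h n)).
  rewrite (eq_mean P E) meanZ; last by apply: bounded_mfun_sum => i; exact: bKX.
  by rewrite mean_sum// => i; exact: bKX.
by rewrite E -mulrBr -sumrB; congr (_ * _); apply: eq_bigr => i _; rewrite mean_kernel.
Qed.

Lemma Lnorm_kernel_estimator (h : nat -> R) n x p : (0 < n)%N -> 0 < p -> 0 < h n ->
  ('N[P]_(p%:E)[(fun w => (kernel_estimator X K h n x w)%:E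
                         - 'E_P[kernel_estimator X K h n x])] `^ p =
  ((n%:R * h n)^-1 `^ p * moment X (centered_kernel (h n) x) p n)%:E)%E.
Proof.
move=> n0 p0 hn.
have y0 : 0 <= (n%:R * h n)^-1 by rewrite invr_ge0 mulr_ge0// ltW.
have bE : bounded_mfun (kernel_estimator X K h n x).
  rewrite /kernel_estimator; apply: bounded_mfunM; first exact: bounded_mfun_cst.
  by apply: bounded_mfun_sum => i; exact: bKX.
have bS := bounded_mfun_powR (ltW p0)
  (bounded_partial_sum X 0 n (bounded_centered_kernel (h n) x)).
rewrite /moment -(meanZ P _ bS) EFin_mean; last first.
  by apply: bounded_mfunM => //; exact: bounded_mfun_cst.
rewrite poweR_Lnorm ?gt_eqF// unlock -EFin_mean//.
apply: eq_integral => w _; rewrite -EFinB kernel_estimator_centered//.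
by rewrite abse_EFin poweR_EFin normrM (ger0_norm y0) powRM.
Qed.

End kernel_estimator_moments.

(** * The integrated error and its rate *)

Lemma is_bigO_bounded {R : realType} (a : nat -> \bar R) (b : nat -> R) (C : R) :
  (\forall n \near \oo, (a n * ((b n)^-1)%:E <= C%:E)%E) -> is_bigO a b.
Proof.
move=> [N _ H]; rewrite /is_bigO /limn_esup limf_esupE.
apply: le_lt_trans (ltry C).
apply: (@le_trans _ _
    (ereal_sup ((fun n => (a n * ((b n)^-1)%:E)%E) @` [set n | (N <= n)%N]))).
  by apply: ereal_inf_lbound; exists [set n | (N <= n)%N] => //; exists N.
by apply: ge_ereal_sup => _ [n Nn <-]; exact: H.
Qed.

Local Open Scope ereal_scope.

Theorem theorem4p2 (d : measure_display) (T : measurableType d)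
    (R : realType) (P : probability T R)
    (p : R) (X : nat -> {RV P >-> R}) (f K : R -> R) (h : nat -> R)
    (hp : (2 <= p)%R)
    (Xstat : stationary X)
    (Xnondeg : forall i : nat, non_degenerate (X i))
    (Xmix : rho_mixing X)
    (Xdens : forall i : nat, has_density (X i) f)
    (hrho : \sum_(0 <= i <oo) rho X (2 ^ i)%N `^ (2 / p) < +oo)
    (h_gt0 : forall n : nat, (0 < h n)%R)
    (h_noninc : nonincreasing_seq h)
    (h_to0 : h n @[n --> \oo] --> (0 : R)%R)
    (nh_toy : (n%:R * h n)%R @[n --> \oo] --> +oo%R)
    (f_bounded : exists M : R, forall x : R, (`|f x| <= M)%R)
    (K_meas : measurable_fun [set: R] K)
    (K_bounded : exists M : R, forall x : R, (`|K x| <= M)%R)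
    (K_int : \int[lebesgue_measure]_x (`|K x|%R)%:E < +oo) :
  is_bigO
    (fun n : nat =>
      (\int[lebesgue_measure]_x
         ('N[P]_(p%:E)[(fun w => (kernel_estimator X K h n x w)%:E
                                - 'E_P[kernel_estimator X K h n x])] `^ p))
      `^ (1 / p))
    (fun n : nat => ((1 / (n%:R * h n)) `^ (1 / 2))%R).
Proof.
have bK : bounded_mfun K by split.
have [M fM'] := f_bounded; have [B KB] := K_bounded.
have fM x : (f x <= M)%R by exact: le_trans (ler_norm _) (fM' x).
have M0 : (0 <= M)%R by exact: le_trans (fM' 0%R).
have B0 : (0 <= B)%R by exact: le_trans (KB 0%R).
have mK : measurable_fun [set: R] (fun x => (`|K x|%R)%:E).
  by apply/measurable_EFinP; exact: measurableT_comp.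
have p0 : (0 < p)%R by lra.
pose I := fine (\int[lebesgue_measure]_x (`|K x|%R)%:E).
have I0 : (0 <= I)%R by rewrite fine_ge0// integral_ge0// => x _; rewrite lee_fin.
have IE : \int[lebesgue_measure]_x (`|K x|%R)%:E = I%:E.
  by rewrite fineK// ge0_fin_numE// integral_ge0// => x _; rewrite lee_fin.
have [A A0 rosenthal] := rosenthal_rho_mixing hp Xstat hrho.
pose C := (M * I)%R.
have C0 : (0 <= C)%R by exact: mulr_ge0.
(* The bounded density and the change of variables [u = x + a y] give a bound uniform in [x]. *)
have kC (a x : R) : (0 < a)%R -> (0 <= kernel_mean X K a x <= C * a)%R.
  move=> a0; apply/andP; split; first exact: mean_ge0.
  have mKx : measurable_fun [set: R] (fun u : R => (`|K ((u - x) / a)|%R)%:E).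
    apply/measurable_EFinP; apply: measurableT_comp => //.
    exact: (measurableT_comp K_meas (measurable_affine x a)).
  rewrite -lee_fin EFin_mean; last first.
    have [_ [b Kb]] := bK; split; last by exists b => w; rewrite normr_id.
    apply: measurableT_comp => //; apply: (measurableT_comp K_meas).
    exact: (measurableT_comp (measurable_affine x a)).
  have := integral_density_le (Xdens 1%N) M0 fM mKx (fun=> normr_ge0 _).
  by rewrite (@ge0_integral_affine R (fun y => (`|K y|%R)%:E) a x)// IE -!EFinM mulrCA mulrC.
(* The two summands come from the two terms of Rosenthal's bound; [I] enters through the integral of
   one factor [kernel_mean]. *)
pose Q := (A * I * ((2 * B) `^ (p - 2) * B + B `^ (p / 2) * C `^ (p / 2 - 1)))%R.
have Q0 : (0 <= Q)%R.
  by rewrite /Q; repeat first [done | exact: powR_ge0 | apply: mulr_ge0 | apply: addr_ge0].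
apply: (@is_bigO_bounded _ _ _ (Q `^ (1 / p))).
(* For [1 <= y] one has [y <= y ^ (p / 2)], which absorbs the linear term of Rosenthal's bound into
   the other. *)
have : \forall n \near \oo, (1 <= n%:R * h n)%R.
  by move/cvgryPge : nh_toy; apply.
move=> nh1; near=> n.
have n0 : (0 < n)%N by near: n; exists 1%N.
have y1 : (1 <= n%:R * h n)%R by near: n.
set y := (n%:R * h n)%R in y1 *.
have y0 : (0 < y)%R by lra.
have yV0 : (0 <= y^-1)%R by rewrite invr_ge0 ltW.
have hn := h_gt0 n.
pose D := (y^-1 `^ p * (A * (n%:R * ((2 * B) `^ (p - 2) * B)
   + (n%:R * B) `^ (p / 2) * (C * h n) `^ (p / 2 - 1))))%R.
have D0 : (0 <= D)%R.
  by rewrite /D; repeat first [done | exact: powR_ge0 | apply: mulr_ge0 | apply: addr_ge0].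
have pointwise x : 'N[P]_(p%:E)[(fun w => (kernel_estimator X K h n x w)%:E
    - 'E_P[kernel_estimator X K h n x])] `^ p <= (D * kernel_mean X K (h n) x)%:E.
  rewrite (Lnorm_kernel_estimator Xdens bK _ n0 p0 hn) lee_fin -/y /D -mulrA.
  apply: ler_wpM2l; first exact: powR_ge0.
  have := @rosenthal _ (bounded_centered_kernel X bK (h n) x)
    (mean_centered_kernel Xdens bK (h n) x) n n0.
  move=> /le_trans; apply; rewrite -mulrA; apply: ler_wpM2l => //.
  have /andP[k0 kh] := kC (h n) x hn.
  set k := kernel_mean X K (h n) x in k0 kh *.
  rewrite mulrDl; apply: lerD.
    rewrite -!mulrA; apply: ler_wpM2l => //.
    exact: momentp_kernel_le.
  apply: (@le_trans _ _ ((n%:R * B * k) `^ (p / 2))%R).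
    apply: ge0_ler_powR; rewrite ?nnegrE ?mulr_ge0 ?moment_ge0//; first lra.
    rewrite -mulrA; apply: ler_wpM2l => //; exact: moment2_kernel_le.
  rewrite powRM ?mulr_ge0// -mulrA; apply: ler_wpM2l; first exact: powR_ge0.
  (* One factor [k] is kept for the integration in [x]; the remaining power [p / 2 - 1] is bounded
     uniformly through [k <= C h]. *)
  rewrite [leRHS]mulrC -(@mulr_powRB1 _ k (p / 2)%R)//; last by lra.
  apply: ler_wpM2l => //; apply: ge0_ler_powR; rewrite ?nnegrE ?mulr_ge0//; first by lra.
  exact: ltW.
have intD : \int[lebesgue_measure]_x (D * kernel_mean X K (h n) x)%:E = (h n * (D * I))%:E.
  (* Absorbing [D] into the kernel spares a proof that [kernel_mean] is measurable in [x]. *)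
  have bDK : bounded_mfun (fun x => D * K x)%R.
    by apply: bounded_mfunM => //; exact: bounded_mfun_cst.
  have bkm x : bounded_mfun (fun w => `|K ((X 1%N w - x) / h n)|%R).
    have [_ [b Kb]] := bK; split; last by exists b => w; rewrite normr_id.
    apply: measurableT_comp => //; apply: (measurableT_comp K_meas).
    exact: (measurableT_comp (measurable_affine x (h n))).
  have := integral_mean_kernel (X 1%N) hn bDK.
  under eq_integral => x _.
    rewrite (@eq_mean _ _ _ P _ (fun w => D * `|K ((X 1%N w - x) / h n)|)%R); last first.
      by move=> w; rewrite normrM ger0_norm.
    rewrite meanZ//; over.
  move=> ->.
  under eq_integral do rewrite normrM (ger0_norm D0) EFinM.
  by rewrite ge0_integralZl_EFin// IE -!EFinM.
have int_le : \int[lebesgue_measure]_x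
    ('N[P]_(p%:E)[(fun w => (kernel_estimator X K h n x w)%:E
    - 'E_P[kernel_estimator X K h n x])] `^ p) <= (Q * y^-1 `^ (p / 2))%:E.
  apply: le_trans (ge0_le_integralT lebesgue_measure (fun x => poweR_ge0 _ _) pointwise) _.
  rewrite intD lee_fin.
  have hpow : (h n * (h n) `^ (p / 2 - 1) = (h n) `^ (p / 2))%R.
    by rewrite mulr_powRB1// ?ltW//; lra.
  have E1 : ((n%:R * B) `^ (p / 2) = n%:R `^ (p / 2) * B `^ (p / 2))%R by rewrite powRM.
  have E2 : ((C * h n) `^ (p / 2 - 1) = C `^ (p / 2 - 1) * h n `^ (p / 2 - 1))%R.
    by rewrite powRM// ltW.
  have E3 : (y `^ (p / 2) = n%:R `^ (p / 2) * h n `^ (p / 2))%R by rewrite powRM// ltW.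
  (* The normalization [y ^ (- p)] of the estimator against the growth [y ^ (p / 2)] of the moments:
     this is the rate. *)
  have E4 : (y^-1 `^ p * y `^ (p / 2) = y^-1 `^ (p / 2))%R.
    rewrite {1}(splitr p) powRD; last by rewrite invr_eq0 (gt_eqF y0) implybT.
    by rewrite -mulrA -powRM// ?ltW// mulVf ?gt_eqF// powR1 mulr1.
  have E5 : (y <= y `^ (p / 2))%R by apply: le1r_powR => //; lra.
  have L : (h n * (D * I) = y^-1 `^ p * (A * I * ((2 * B) `^ (p - 2) * B * y
      + B `^ (p / 2) * C `^ (p / 2 - 1) * y `^ (p / 2))))%R.
    rewrite /D E1 E2 E3 -hpow /y; ring.
  rewrite L -E4 /Q -subr_ge0.
  rewrite [leRHS](_ : _ = y^-1 `^ p * (A * I * ((2 * B) `^ (p - 2) * B * (y `^ (p / 2) - y))))%R;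
    last by ring.
  by repeat first [done | exact: powR_ge0 | rewrite subr_ge0 | apply: mulr_ge0].
have yp0 : (0 < y^-1 `^ (1 / 2))%R by rewrite powR_gt0// invr_gt0.
rewrite (div1r y).
rewrite lee_pdivrMr// -EFinM.
have -> : (Q `^ (1 / p) * y^-1 `^ (1 / 2) = (Q * y^-1 `^ (p / 2)) `^ (1 / p))%R.
  rewrite [RHS]powRM ?powR_ge0// -powRrM; congr (_ * _ `^ _)%R.
  by field; rewrite gt_eqF.
rewrite -poweR_EFin; apply: gt0_ler_poweR => //; first by rewrite divr_ge0// ltW.
- by rewrite in_itv /= leey andbT integral_ge0// => x _; exact: poweR_ge0.
- by rewrite in_itv /= leey andbT lee_fin mulr_ge0// powR_ge0.
Unshelve. all: by end_near.
Qed.
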